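(* Let $C$ be a convex disc in the plane. (i) The Hadwiger number is $H(C)=6$ if $C$ is not a parallelogram and $H(C)=8$ if $C$ is a parallelogram. (ii) The strict Hadwiger number is $H'(C)=5$ if $C$ is not a parallelogram and $H'(C)=4$ if $C$ is a parallelogram. (iii) The one-sided Hadwiger number is $H_{+}(C)=4$ if $C$ is not a parallelogram and $H_{+}(C)=5$ if $C$ is a parallelogram. (iv) The open one-sided Hadwiger number of $C$ is $H_{+}^{o}(C)=4$ if $\lambda(\frac12(C-C))>1$, and $H_{+}^{o}(C)=3$ otherwise.
   Context: A convex disc is a convex body (compact convex set with non-empty interior) in $\mathbb{R}^2$. Two convex bodies touch if they intersect but have disjoint interiors; they overlap if their interiors intersect. A Hadwiger family of $C$ is a collection of translates of $C$, all touching $C$ and with pairwise disjoint interiors; $H(C)$ is the maximum number of translates in a Hadwiger family of $C$. A strict Hadwiger family of $C$ is a collection of translates of $C$, all touching $C$ and pairwise disjoint; $H'(C)$ is the maximum number of translates in a strict Hadwiger family of $C$. $H_{+}(C)$ is the maximum number of translates in a Hadwiger family $\{v_i+C : i\in I\}$ such that $\{v_i : i\in I\}$ is contained in a closed half plane with the origin on its boundary; $H_{+}^{o}(C)$ is defined in the same way with ''closed half plane'' replaced by ''open half plane'' (with the origin on its boundary). For an origin-symmetric convex disc $B$, $\lambda(B)$ is the largest length of a segment contained in the boundary $\partial B$, where length is measured in the norm with unit ball $B$. Here $\frac12(C-C)=\{\frac12(x-y): x,y\in C\}$. *)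

(* Defs.v *)
From HB Require Import structures.
From mathcomp Require Import all_boot all_order all_algebra.
From mathcomp Require Import all_classical all_reals all_analysis.

Set Implicit Arguments.
Unset Strict Implicit.
Unset Printing Implicit Defensive.

Import Order.TTheory GRing.Theory Num.Theory.
Import numFieldNormedType.Exports.

Local Open Scope classical_set_scope.
Local Open Scope card_scope.
Local Open Scope ring_scope.

Definition convex_disc (R : realType) (C : set 'rV[R]_2) : Prop :=
  [/\ compact C, convex_set C & C° !=set0].

Definition translate (R : realType) (C : set 'rV[R]_2) (v : 'rV[R]_2) :
    set 'rV[R]_2 :=
  [set v + x | x in C].

Definition touch (R : realType) (A B : set 'rV[R]_2) : Prop :=
  A `&` B !=set0 /\ A° `&` B° = set0.

(* A family of translates of C is represented by its set V of translation
   vectors. Nothing is lost: distinct vectors give distinct translates because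
   C is bounded and nonempty, and members of an indexed family whose interiors
   are pairwise disjoint cannot be repeated because C has interior points. *)
Definition hadwiger_family (R : realType) (C V : set 'rV[R]_2) : Prop :=
  (forall v, V v -> touch (translate C v) C) /\
  trivIset V (fun v => (translate C v)°).

Definition strict_hadwiger_family (R : realType) (C V : set 'rV[R]_2) : Prop :=
  (forall v, V v -> touch (translate C v) C) /\
  trivIset V (translate C).

Definition closed_half_plane (R : realType) (n : 'rV[R]_2) : set 'rV[R]_2 :=
  [set x | 0 <= (x *m n^T) 0 0].

Definition open_half_plane (R : realType) (n : 'rV[R]_2) : set 'rV[R]_2 :=
  [set x | 0 < (x *m n^T) 0 0].

Definition is_max_cardinality (T : Type) (P : set (set T)) (n : nat) : Prop :=
  (exists2 V, P V & V #= `I_n) /\ (forall V, P V -> V #<= `I_n).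

(* The default value 0 is used when P has no member of maximal finite
   cardinality, so max_cardinality P = n with n > 0 does assert
   is_max_cardinality P n. *)
Definition max_cardinality (T : Type) (P : set (set T)) : nat :=
  xget 0%N (is_max_cardinality P).

Definition hadwiger_number (R : realType) (C : set 'rV[R]_2) : nat :=
  max_cardinality (hadwiger_family C).

Definition strict_hadwiger_number (R : realType) (C : set 'rV[R]_2) : nat :=
  max_cardinality (strict_hadwiger_family C).

Definition one_sided_hadwiger_number (R : realType) (C : set 'rV[R]_2) : nat :=
  max_cardinality [set V | hadwiger_family C V /\
                    exists2 n, n != 0 & V `<=` closed_half_plane n].

Definition open_one_sided_hadwiger_number (R : realType) (C : set 'rV[R]_2) :
    nat :=
  max_cardinality [set V | hadwiger_family C V /\
                    exists2 n, n != 0 & V `<=` open_half_plane n].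

Definition parallelogram (R : realType) (C : set 'rV[R]_2) : Prop :=
  exists a u w : 'rV[R]_2, row_free (col_mx u w) /\
    C = [set a + s *: u + t *: w | s in `[0, 1] & t in `[0, 1]].

Definition half_difference (R : realType) (C : set 'rV[R]_2) : set 'rV[R]_2 :=
  [set 2^-1 *: (x - y) | x in C & y in C].

Definition frontier (R : realType) (B : set 'rV[R]_2) : set 'rV[R]_2 :=
  closure B `\` B°.

Definition segment (R : realType) (x y : 'rV[R]_2) : set 'rV[R]_2 :=
  [set (1 - t) *: x + t *: y | t in `[0, 1]].

(* The norm with unit ball B, when B is an origin-symmetric convex disc. *)
Definition gauge_norm (R : realType) (B : set 'rV[R]_2) (x : 'rV[R]_2) : R :=
  inf [set r | 0 < r /\ B (r^-1 *: x)].

(* Degenerate segments are allowed, so that lambda B = 0 when B is strictly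
   convex. For an origin-symmetric convex disc B the supremum is attained,
   since the frontier of B is compact. *)
Definition lambda (R : realType) (B : set 'rV[R]_2) : R :=
  sup [set l | exists x y : 'rV[R]_2,
         segment x y `<=` frontier B /\ l = gauge_norm B (y - x)].

(* Main.v *)
Require Import Defs.
From HB Require Import structures.
From mathcomp Require Import all_boot all_order all_algebra.
From mathcomp Require Import all_classical all_reals all_analysis.
From mathcomp Require Import ring lra.

(* Let N be the norm with unit ball C - C.  A Hadwiger family of C is the same
   as a set of N-unit vectors at mutual distances >= 1, a strict one as a set of
   N-unit vectors at mutual distances > 1.

   Every unit vector u extends to an inscribed affine regular hexagon u, v,
   v - u, -u, -v, u - v.  Two unit vectors in the cone of two consecutive
   vertices are at distance <= 1, and at distance 1 only if the ball is a
   parallelogram (equivalently N (u + v) = 1), or they are the two vertices, or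
   one is a vertex and the other lies on the prolongation of a side contained in
   the boundary.  The upper bounds follow by covering the plane, or a half plane,
   with half-open cones and choosing the hexagon so that the last case does not
   arise; parallelograms are treated in coordinates.

   For five unit vectors at distances > 1, start from a unit vector w, choose v
   and s at distance 1 from w, one on each side and as far from w as possible,
   then p beyond v and q beyond s in the same way.  If the ball is not a
   parallelogram all other distances exceed 1, and small moves of p and q, then
   of v and s, make the four remaining ones exceed 1 as well. *)

Set Implicit Arguments.
Unset Strict Implicit.
Unset Printing Implicit Defensive.

Import Order.TTheory GRing.Theory Num.Theory.
Import numFieldNormedType.Exports.

Local Open Scope classical_set_scope.
Local Open Scope card_scope.
Local Open Scope ring_scope.

(** * Norms on the plane and inscribed hexagons *)

(** Using [C - C] rather than its half turns the meeting of translates into [N (v - w) <= 1].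
    Halving rescales ball and segments together, so [long_face] still says that [lambda] exceeds 1.
    The obstacle to the upper bounds is a boundary segment longer than 1: a hexagon with a side on
    it can have the pair [u], [v + t *: u] at distance exactly 1 inside one half-open cone [u, v).
    The main tool against it is [face_support]: a line carrying three suitably placed points of norm
    1 supports the ball, so the corresponding linear coordinate is bounded by [N]. Two bad pairs at
    once then produce a unit vector beyond a supporting line. For five vectors the difficulty is
    reversed: four distances start at exactly 1. A vector that has been slid to the far end of its
    boundary segment can be moved off its neighbour, which is why each choice is extremal. *)

Ltac vec := apply/rowP => ?; rewrite ?mxE; ring.
Ltac vecf := apply/rowP => ?; rewrite ?mxE; field.

Lemma rV2P (R : realType) (x y : 'rV[R]_2) :
  x 0 0 = y 0 0 -> x 0 1 = y 0 1 -> x = y.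
Proof.
move=> h0 h1; apply/rowP => -[[|[|//]]] h.
- by rewrite (_ : Ordinal h = 0) //; apply: val_inj.
- by rewrite (_ : Ordinal h = 1) //; apply: val_inj.
Qed.

Definition indep (R : realType) (u v : 'rV[R]_2) :=
  forall a b : R, a *: u + b *: v = 0 -> a = 0 /\ b = 0.

(** A vanishing determinant turns the coordinates into coefficients of linear relations, so they all
    vanish, and then [1 *: u + 0 *: v = 0] is a nontrivial relation. *)
Lemma indep_det (R : realType) (u v : 'rV[R]_2) :
  indep u v -> u 0 0 * v 0 1 - u 0 1 * v 0 0 != 0.
Proof.
move=> ind; apply/eqP => d0.
have [v1 u1] : v 0 1 = 0 /\ - u 0 1 = 0.
  by apply: ind; apply: rV2P; rewrite !mxE; [rewrite -d0|]; ring.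
have [v0 u0] : v 0 0 = 0 /\ - u 0 0 = 0.
  by apply: ind; apply: rV2P; rewrite !mxE; [|rewrite -[RHS]oppr0 -d0]; ring.
have [] : (1 : R) = 0 /\ (0 : R) = 0.
  by apply: ind; apply: rV2P; rewrite !mxE; lra.
by move/eqP; rewrite oner_eq0.
Qed.

Lemma indep_span (R : realType) (u v : 'rV[R]_2) : indep u v ->
  forall z, exists a b : R, z = a *: u + b *: v.
Proof.
move=> /indep_det d0 z.
exists ((z 0 0 * v 0 1 - z 0 1 * v 0 0) / (u 0 0 * v 0 1 - u 0 1 * v 0 0)).
exists ((u 0 0 * z 0 1 - u 0 1 * z 0 0) / (u 0 0 * v 0 1 - u 0 1 * v 0 0)).
by apply: rV2P; rewrite !mxE; field.
Qed.

Definition dot (R : realType) (x n : 'rV[R]_2) : R := (x *m n^T) 0 0.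

Lemma dotE (R : realType) (x n : 'rV[R]_2) :
  dot x n = x 0 0 * n 0 0 + x 0 1 * n 0 1.
Proof.
rewrite /dot mxE !big_ord_recl big_ord0 !mxE addr0.
by rewrite (_ : lift ord0 ord0 = 1) //; apply: val_inj.
Qed.

Lemma dot_lin (R : realType) (a b : R) (x y n : 'rV[R]_2) :
  dot (a *: x + b *: y) n = a * dot x n + b * dot y n.
Proof. by rewrite !dotE !mxE; ring. Qed.

Lemma indep_dot (R : realType) (u v : 'rV[R]_2) (a b : R) : indep u v ->
  exists n, dot u n = a /\ dot v n = b.
Proof.
move=> /indep_det d0.
pose D := u 0 0 * v 0 1 - u 0 1 * v 0 0.
exists (\row_j if j == 0 then (a * v 0 1 - b * u 0 1) / D
               else (b * u 0 0 - a * v 0 0) / D).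
by rewrite !dotE !mxE /= /D; split; field.
Qed.

Record is_norm (R : realType) (N : 'rV[R]_2 -> R) : Prop := IsNorm {
  normD : forall x y, N (x + y) <= N x + N y;
  normZ : forall a x, N (a *: x) = `|a| * N x;
  norm_eq0 : forall x, N x = 0 -> x = 0 }.

Section PlaneNorm.
Variables (R : realType) (N : 'rV[R]_2 -> R) (hN : is_norm N).
Implicit Types (u v w x y z e p q m : 'rV[R]_2) (a b c d t : R).

Lemma normN x : N (- x) = N x.
Proof. by rewrite -scaleN1r (normZ hN) normrN normr1 mul1r. Qed.

Lemma norm0 : N 0 = 0.
Proof. by rewrite -(scale0r (0 : 'rV_2)) (normZ hN) normr0 mul0r. Qed.

Lemma norm_ge0 x : 0 <= N x.
Proof. by have := normD hN x (- x); rewrite subrr norm0 normN; lra. Qed.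

Lemma norm_gt0 x : x <> 0 -> 0 < N x.
Proof.
move=> x0; rewrite lt_def norm_ge0 andbT; apply/eqP => /(norm_eq0 hN).
exact: x0.
Qed.

Lemma normBC x y : N (x - y) = N (y - x).
Proof. by rewrite -normN opprB. Qed.

Lemma norm_comb z a b x y : 0 <= a -> 0 <= b -> z = a *: x + b *: y ->
  N z <= a * N x + b * N y.
Proof.
move=> a0 b0 ->; apply: (le_trans (normD hN _ _)).
by rewrite !(normZ hN) !ger0_norm.
Qed.

Lemma norm_lip x y : `|N x - N y| <= N (x - y).
Proof.
have := normD hN (x - y) y; have := normD hN (y - x) x.
by rewrite !subrK (normBC y x) ler_norml => *; lra.
Qed.

(** On the line [x + t *: e] the norm is convex, at most 1 at two points and at least 1 at a point
    between them, hence at least 1 on the whole line. The line thus misses the open ball, and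
    homogeneity bounds the [x]-coordinate of every vector by its norm. *)
Lemma face_support x e p m q a c b :
  p = x + a *: e -> m = x + c *: e -> q = x + b *: e -> a < c -> c < b ->
  N p <= 1 -> N q <= 1 -> 1 <= N m ->
  forall (s t : R), `|s| <= N (s *: x + t *: e).
Proof.
move=> -> -> -> ac cb Np Nq Nm.
have line d : 1 <= N (x + d *: e).
  have [dc|dc|->//] := ltgtP d c.
  - have : N ((b - d) *: (x + c *: e)) <=
      (b - c) * N (x + d *: e) + (c - d) * N (x + b *: e).
      by apply: norm_comb; [lra|lra|vec].
    by rewrite (normZ hN) ger0_norm; [nra|lra].
  - have : N ((d - a) *: (x + c *: e)) <=
      (d - c) * N (x + a *: e) + (c - a) * N (x + d *: e).
      by apply: norm_comb; [lra|lra|vec].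
    by rewrite (normZ hN) ger0_norm; [nra|lra].
move=> s t; have [->|s0] := eqVneq s 0; first by rewrite normr0 norm_ge0.
have -> : s *: x + t *: e = s *: (x + (t / s) *: e) by vecf.
by rewrite (normZ hN) ler_peMr.
Qed.

Definition hex u v := [/\ N u = 1, N v = 1 & N (v - u) = 1].

Lemma hex_sym u v : hex u v -> hex v u.
Proof. by case=> u1 v1 d1; split=> //; rewrite normBC. Qed.

Lemma hex_rot u v : hex u v -> hex v (v - u).
Proof.
case=> u1 v1 d1; split=> //.
by rewrite (_ : _ - _ = - u) ?normN //; vec.
Qed.

Lemma hex_opp u v : hex u v -> hex (- u) (- v).
Proof. by case=> u1 v1 d1; split; rewrite ?normN // -opprD normN. Qed.

(** The unit vectors [u - v] and [u] lie on the line [a = 1]; by convexity the norm is at least 1 on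
    that line beyond [u], that is, where [b >= 0]. *)
Lemma hex_coordl u v a b : hex u v -> 0 <= b -> a <= N (a *: u + b *: v).
Proof.
case=> u1 v1 d1 b0.
have : N ((a + b) *: u) <= b * N (u - v) + 1 * N (a *: u + b *: v).
  by apply: norm_comb; [lra|lra|vec].
rewrite (normZ hN) u1 normBC d1; have := ler_norm (a + b); lra.
Qed.

Lemma hex_coordr u v a b : hex u v -> 0 <= a -> b <= N (a *: u + b *: v).
Proof. by move=> /hex_sym h a0; rewrite addrC; apply: hex_coordl. Qed.

Lemma hex_add_ge1 u v : hex u v -> 1 <= N (u + v).
Proof.
by move=> h; rewrite -[u]scale1r -[v]scale1r; apply: hex_coordl h ler01.
Qed.

(** A relation has coefficients of equal absolute value, so it is a multiple of [u + v] or [v - u],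
    and neither of these is zero. *)
Lemma hex_indep u v : hex u v -> indep u v.
Proof.
move=> h a b e; have [u1 v1 d1] := h.
have : `|a| = `|b|.
  have : N (a *: u) = N (b *: v).
    by rewrite -(normN (b *: v)); congr N; apply/eqP; rewrite -addr_eq0 e.
  by rewrite !(normZ hN) u1 v1 !mulr1.
move=> /eqP; rewrite eqr_norm2 => /orP[]/eqP ab.
- have : N (a *: (u + v)) = 0 by rewrite scalerDr {2}ab e norm0.
  rewrite (normZ hN) => /eqP; rewrite mulf_eq0 normr_eq0 => /orP[|] /eqP.
  + by move=> a0; split; lra.
  + by have := hex_add_ge1 h; lra.
- have : N (a *: (v - u)) = 0.
    have -> : a *: (v - u) = - (a *: u + b *: v) by rewrite ab; vec.
    by rewrite e oppr0 norm0.
  by rewrite (normZ hN) d1 mulr1 => /eqP; rewrite normr_eq0 => /eqP; split; lra.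
Qed.

Definition cone u v z := exists a b, [/\ 0 <= a, 0 <= b & z = a *: u + b *: v].

(* The half-open cone [u, v). *)
Definition hcone u v z := exists a b, [/\ 0 < a, 0 <= b & z = a *: u + b *: v].

Lemma hcone_cone u v z : hcone u v z -> cone u v z.
Proof. by case=> a [b [a0 b0 ->]]; exists a, b; split=> //; exact: ltW. Qed.

Lemma cone_sym u v z : cone u v z -> cone v u z.
Proof. by case=> a [b [a0 b0 ->]]; exists b, a; split=> //; rewrite addrC. Qed.

Lemma hcone_neqr u v z : hex u v -> hcone u v z -> z <> v.
Proof.
move=> h [a [b [a0 b0 ->]]] e.
have [] : a = 0 /\ b - 1 = 0; last lra.
by apply: (hex_indep h); rewrite scalerBl scale1r addrA e subrr.
Qed.

(** Unit vectors of the cone have coordinates [a <= 1], [b <= 1] and [a + b >= 1]. If the coordinate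
    differences have the same sign, their sum is at most 2 - 1; if the signs differ, splitting along
    [u - v] and one of [u], [v] bounds the norm by the larger difference. *)
Lemma sector_le u v z1 z2 : hex u v -> cone u v z1 -> cone u v z2 ->
  N z1 = 1 -> N z2 = 1 -> N (z1 - z2) <= 1.
Proof.
move=> h [a1 [b1 [a10 b10 ->]]] [a2 [b2 [a20 b20 ->]]] n1 n2.
have [u1 v1 d1] := h.
have := hex_coordl a1 h b10; have := hex_coordr b1 h a10.
have := hex_coordl a2 h b20; have := hex_coordr b2 h a20.
have s1 : N (a1 *: u + b1 *: v) <= a1 * N u + b1 * N v by apply: norm_comb.
have s2 : N (a2 *: u + b2 *: v) <= a2 * N u + b2 * N v by apply: norm_comb.
rewrite n1 n2 u1 v1 in s1 s2 * => B2 A2 B1 A1.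
have [p0|p0] := leP 0 (a1 - a2); have [q0|q0] := leP 0 (b1 - b2).
- have : N (a1 *: u + b1 *: v - (a2 *: u + b2 *: v)) <=
    (a1 - a2) * N u + (b1 - b2) * N v by apply: norm_comb; [lra|lra|vec].
  by rewrite u1 v1; lra.
- have [pq|pq] := leP (b2 - b1) (a1 - a2).
  + have : N (a1 *: u + b1 *: v - (a2 *: u + b2 *: v)) <=
      (b2 - b1) * N (u - v) + (a1 - a2 - (b2 - b1)) * N u.
      by apply: norm_comb; [lra|lra|vec].
    by rewrite u1 normBC d1; lra.
  + have : N (a1 *: u + b1 *: v - (a2 *: u + b2 *: v)) <=
      (a1 - a2) * N (u - v) + (b2 - b1 - (a1 - a2)) * N (- v).
      by apply: norm_comb; [lra|lra|vec].
    by rewrite normN v1 normBC d1; lra.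
- have [pq|pq] := leP (a2 - a1) (b1 - b2).
  + have : N (a1 *: u + b1 *: v - (a2 *: u + b2 *: v)) <=
      (a2 - a1) * N (v - u) + (b1 - b2 - (a2 - a1)) * N v.
      by apply: norm_comb; [lra|lra|vec].
    by rewrite v1 d1; lra.
  + have : N (a1 *: u + b1 *: v - (a2 *: u + b2 *: v)) <=
      (b1 - b2) * N (v - u) + (a2 - a1 - (b1 - b2)) * N (- u).
      by apply: norm_comb; [lra|lra|vec].
    by rewrite normN u1 d1; lra.
- have : N (a1 *: u + b1 *: v - (a2 *: u + b2 *: v)) <=
    (a2 - a1) * N (- u) + (b2 - b1) * N (- v).
    by apply: norm_comb; [lra|lra|vec].
  by rewrite !normN u1 v1; lra.
Qed.

End PlaneNorm.

(** * Extremal hexagons *)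

Section Extremes.
Variables (R : realType) (N : 'rV[R]_2 -> R) (hN : is_norm N).
Implicit Types (u v w x y z e p q m n : 'rV[R]_2) (a b c d t : R).

(** These are the equality cases of the estimates in [sector_le]: same signs force both coordinates
    of one vector to be 1, and opposite signs force a coordinate to go from 0 to 1, which makes one
    of the vectors a vertex. *)
Lemma sector_far u v z1 z2 : hex N u v -> cone u v z1 -> cone u v z2 ->
  N z1 = 1 -> N z2 = 1 -> 1 <= N (z1 - z2) ->
  N (u + v) <= 1 \/ exists2 t, 0 <= t &
    [\/ z1 = u /\ z2 = v + t *: u, z2 = u /\ z1 = v + t *: u,
        z1 = v /\ z2 = u + t *: v | z2 = v /\ z1 = u + t *: v].
Proof.
move=> h [a1 [b1 [a10 b10 ->]]] [a2 [b2 [a20 b20 ->]]] n1 n2.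
have [u1 v1 d1] := h.
have := hex_coordl hN a1 h b10; have := hex_coordr hN b1 h a10.
have := hex_coordl hN a2 h b20; have := hex_coordr hN b2 h a20.
have s1 : N (a1 *: u + b1 *: v) <= a1 * N u + b1 * N v by apply: (norm_comb hN).
have s2 : N (a2 *: u + b2 *: v) <= a2 * N u + b2 * N v by apply: (norm_comb hN).
rewrite n1 n2 u1 v1 in s1 s2 * => B2 A2 B1 A1 far.
have [p0|p0] := leP 0 (a1 - a2); have [q0|q0] := leP 0 (b1 - b2).
- left; have : N (a1 *: u + b1 *: v - (a2 *: u + b2 *: v)) <=
    (a1 - a2) * N u + (b1 - b2) * N v by apply: (norm_comb hN); [lra|lra|vec].
  rewrite u1 v1 => H; have [e1 e2] : a1 = 1 /\ b1 = 1 by split; lra.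
  by rewrite -n1 e1 e2 !scale1r.
- have [pq|pq] := leP (b2 - b1) (a1 - a2).
  + have : N (a1 *: u + b1 *: v - (a2 *: u + b2 *: v)) <=
      (b2 - b1) * N (u - v) + (a1 - a2 - (b2 - b1)) * N u.
      by apply: (norm_comb hN); [lra|lra|vec].
    rewrite u1 (normBC hN u) d1 => H.
    have [e1 e2 e3] : [/\ a1 = 1, a2 = 0 & b2 = 1] by split; lra.
    right; exists b1 => //; apply: Or44; rewrite e1 e2 e3.
    by split; vec.
  + have : N (a1 *: u + b1 *: v - (a2 *: u + b2 *: v)) <=
      (a1 - a2) * N (u - v) + (b2 - b1 - (a1 - a2)) * N (- v).
      by apply: (norm_comb hN); [lra|lra|vec].
    rewrite (normN hN) v1 (normBC hN u) d1 => H.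
    have [e1 e2 e3] : [/\ a1 = 1, b1 = 0 & b2 = 1] by split; lra.
    right; exists a2 => //; apply: Or41; rewrite e1 e2 e3.
    by split; vec.
- have [pq|pq] := leP (a2 - a1) (b1 - b2).
  + have : N (a1 *: u + b1 *: v - (a2 *: u + b2 *: v)) <=
      (a2 - a1) * N (v - u) + (b1 - b2 - (a2 - a1)) * N v.
      by apply: (norm_comb hN); [lra|lra|vec].
    rewrite v1 d1 => H.
    have [e1 e2 e3] : [/\ b1 = 1, b2 = 0 & a2 = 1] by split; lra.
    right; exists a1 => //; apply: Or42; rewrite e1 e2 e3.
    by split; vec.
  + have : N (a1 *: u + b1 *: v - (a2 *: u + b2 *: v)) <=
      (b1 - b2) * N (v - u) + (a2 - a1 - (b1 - b2)) * N (- u).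
      by apply: (norm_comb hN); [lra|lra|vec].
    rewrite (normN hN) u1 d1 => H.
    have [e1 e2 e3] : [/\ b1 = 1, a1 = 0 & a2 = 1] by split; lra.
    right; exists b2 => //; apply: Or43; rewrite e1 e2 e3.
    by split; vec.
- left; have : N (a1 *: u + b1 *: v - (a2 *: u + b2 *: v)) <=
    (a2 - a1) * N (- u) + (b2 - b1) * N (- v).
    by apply: (norm_comb hN); [lra|lra|vec].
  rewrite !(normN hN) u1 v1 => H; have [e1 e2] : a2 = 1 /\ b2 = 1 by split; lra.
  by rewrite -n2 e1 e2 !scale1r.
Qed.

(** The points [u - v], [u], [u + v] are collinear and show that [a = 1] supports the ball; likewise
    [b = 1]. The reverse inequality comes from writing a vector in terms of [u + v] and [u - v],
    since [|a + b| / 2 + |a - b| / 2] is the maximum. *)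
Lemma hex_square u v : hex N u v -> N (u + v) <= 1 ->
  forall a b, N (a *: u + b *: v) = Num.max `|a| `|b|.
Proof.
move=> h uv a b; have [u1 v1 d1] := h.
have supl : `|a| <= N (a *: u + b *: v).
  apply: (@face_support _ _ hN u v (u - v) u (u + v) (-1) 0 1);
    rewrite ?u1 ?(normBC hN u) ?d1 //; first [by vec | lra].
have supr : `|b| <= N (a *: u + b *: v).
  rewrite addrC.
  apply: (@face_support _ _ hN v u (v - u) v (u + v) (-1) 0 1);
    rewrite ?v1 ?d1 //; first [by vec | lra].
apply/eqP; rewrite eq_le ge_max supl supr !andbT.
have : N (a *: u + b *: v) <=
    `|(a + b) / 2| * N (u + v) + `|(a - b) / 2| * N (u - v).
  rewrite -!(normZ hN) (_ : a *: u + b *: v =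
    ((a + b) / 2) *: (u + v) + ((a - b) / 2) *: (u - v)); last by vecf.
  exact: (normD hN).
rewrite (normBC hN u) d1; move: uv (norm_ge0 hN (u + v)) => uv uv0.
have [a0|a0] := leP 0 a; have [b0|b0] := leP 0 b;
  rewrite ?(ger0_norm a0) ?(ltr0_norm a0) ?(ger0_norm b0) ?(ltr0_norm b0);
  rewrite le_max => H; apply/orP;
  have [s0|s0] := leP 0 ((a + b) / 2); have [r0|r0] := leP 0 ((a - b) / 2);
  rewrite ?(ger0_norm s0) ?(ltr0_norm s0) ?(ger0_norm r0) ?(ltr0_norm r0) in H;
  solve [left; nra | right; nra].
Qed.

(** [c] is the last parameter at which the ray is in the ball. Along a unit direction the norm
    changes no faster than the parameter, so its value at the supremum is exactly 1. *)
Lemma chord_end z e : N z <= 1 -> N e = 1 ->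
  exists c, [/\ 0 <= c, N (z + c *: e) = 1 &
    forall d, c < d -> 1 < N (z + d *: e)].
Proof.
move=> z1 e1; pose S := [set c : R | 0 <= c /\ N (z + c *: e) <= 1].
have S0 : S 0 by split; rewrite // scale0r addr0.
have ubS : has_ubound S.
  exists 2 => c [c0 Nc].
  have : N (c *: e) <= 1 * N (z + c *: e) + 1 * N (- z).
    by apply: (norm_comb hN); [lra|lra|vec].
  by rewrite (normZ hN) ger0_norm // e1 (normN hN); lra.
have hS : has_sup S by split; [exists 0|].
have step a b : a <= b -> N (z + b *: e) <= N (z + a *: e) + (b - a).
  move=> ab; have : N (z + b *: e) <= 1 * N (z + a *: e) + (b - a) * N e.
    by apply: (norm_comb hN); [lra|lra|vec].
  by rewrite e1; lra.
exists (sup S); have sup0 : 0 <= sup S by exact: ub_le_sup.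
have out d : sup S < d -> 1 < N (z + d *: e).
  move=> cd; rewrite ltNge; apply/negP => Nd.
  have : d <= sup S by apply: ub_le_sup => //; split=> //; lra.
  lra.
split=> //; apply/eqP; rewrite eq_le; apply/andP; split; rewrite leNgt.
- apply/negP => gt1.
  have := @sup_adherent _ S (N (z + sup S *: e) - 1).
  case=> [||c [c0 Nc] cS]; [lra|by []|].
  have := step c (sup S); have : c <= sup S by exact: ub_le_sup.
  by move=> cs /(_ cs); lra.
- apply/negP => lt1.
  have := out (sup S + (1 - N (z + sup S *: e))).
  have := step (sup S) (sup S + (1 - N (z + sup S *: e))).
  by move=> H1 H2; have := H1 ltac:(lra); have := H2 ltac:(lra); lra.
Qed.

(** Sliding [v] along [u] to the end of its boundary segment keeps a hexagon: [v + c *: u - u] lies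
    between [v - u] and [v + c *: u], on a supporting line. Afterwards no [v + t *: u] with [t > 0]
    is a unit vector. *)
Lemma hex_rightmost u v : hex N u v -> exists c, [/\ 0 <= c,
  hex N u (v + c *: u) & forall d, 0 < d -> 1 < N (v + c *: u + d *: u)].
Proof.
move=> h; have [u1 v1 d1] := h.
have [||c [c0 Nc out]] := @chord_end v u; rewrite ?v1 //.
exists c; split=> //; last first.
  by move=> d d0; rewrite -addrA -scalerDl; apply: out; lra.
split=> //; have [->|cn0] := eqVneq c 0; first by rewrite scale0r addr0.
have cp : 0 < c by lra.
apply/eqP; rewrite eq_le; apply/andP; split.
  have : (1 + c) * N (v + c *: u - u) <= c * N (v + c *: u) + 1 * N (v - u).
    rewrite -[X in X * _]ger0_norm; last lra.
    by rewrite -(normZ hN); apply: (norm_comb hN); [lra|lra|vec].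
  by rewrite Nc d1; nra.
have -> : v + c *: u - u = 1 *: v + (c - 1) *: u by vec.
rewrite -[X in X <= _]normr1.
apply: (@face_support _ _ hN v u (v - u) v (v + c *: u) (-1) 0 c);
  rewrite ?v1 ?Nc ?d1 //; first [by vec | lra].
Qed.

(** [v - w] is the end, in direction [- w], of the boundary segment through it; this is what allows
    [leftmost_perturb] to move [v] off [w]. *)
Definition leftmost w v := hex N w v /\ forall d, 0 < d -> 1 < N (v - w - d *: w).

Lemma hex_leftmost w v : hex N w v ->
  exists c, 0 <= c /\ leftmost w (v - c *: w).
Proof.
case=> w1 v1 d1.
(* Mirror image: rightmost for the pair [- w], [v - w] is leftmost for [w], [v]. *)
have [|c [c0 [_ c1 c2] out]] := @hex_rightmost (- w) (v - w).
  by split; rewrite ?(normN hN) // opprK subrK.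
exists c; split=> //; split; [split=> //|].
- by rewrite -c2; congr N; vec.
- by rewrite -c1; congr N; vec.
- by move=> d /out; congr (_ < N _); vec.
Qed.

(** For [t >= 1] the vector [t *: (u + v)] is a sum of [(t - 1) *: v] and [v + t *: u], so its norm
    would be at most [t]. *)
Lemma hex_line_lt1 u v t : hex N u v -> 1 < N (u + v) -> N (v + t *: u) <= 1 ->
  t < 1.
Proof.
case=> u1 v1 d1 uv Nt; rewrite ltNge; apply/negP => t1.
have : N (t *: (u + v)) <= (t - 1) * N v + 1 * N (v + t *: u).
  by apply: (norm_comb hN); [lra|lra|vec].
by rewrite (normZ hN) ger0_norm ?v1; [nra|lra].
Qed.

Lemma lipschitz_continuous (f : R -> R) (K : R) :
  (forall s t, `|f s - f t| <= K * `|s - t|) -> continuous f.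
Proof.
move=> lip x; apply/cvgrPdist_lt => eps eps0.
have K0 : 0 <= K.
  by have := lip 1 0; rewrite subr0 normr1 mulr1; apply: le_trans.
near=> y; apply: (le_lt_trans (lip _ _)).
have : `|x - y| < eps / (K + 1).
  by near: y; apply: cvgr_dist_lt; [exact: cvg_id|rewrite divr_gt0 //; lra].
rewrite ltr_pdivlMr; last lra.
have := normr_ge0 (x - y); nra.
Unshelve. all: by end_near. Qed.

(** Intermediate value theorem along the broken line [z] from [u] through [w] to [- u]. The function
    [G] is [N (z t)] times the excess over 1 of the distance from [u] to the normalised [z t]; the
    factor avoids a division and keeps [G] Lipschitz. An interior zero has a positive
    [w]-coefficient, so [v] is on the side of [w]. *)
Lemma hex_exists u w : N u = 1 -> indep u w ->
  exists v, hex N u v /\ exists a b, 0 < b /\ v = a *: u + b *: w.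
Proof.
move=> u1 ind; pose z t := (- t) *: u + (1 - `|t|) *: w.
pose G t := N (z t - N (z t) *: u) - N (z t).
have zlip s t : N (z s - z t) <= (1 + N w) * `|s - t|.
  have : N (z s - z t) <= `|t - s| * N u + `| `|t| - `|s| | * N w.
    rewrite -!(normZ hN) (_ : z s - z t = (t - s) *: u + (`|t| - `|s|) *: w).
      exact: (normD hN).
    by rewrite /z; vec.
  have := ler_dist_dist t s; have := norm_ge0 hN w.
  by rewrite u1 (distrC s t); nra.
have Nlip s t : `|N (z s) - N (z t)| <= (1 + N w) * `|s - t|.
  exact: le_trans (norm_lip hN _ _) _.
have Glip s t : `|G s - G t| <= (3 * (1 + N w)) * `|s - t|.
  have : `|G s - G t| <= `|N (z s - N (z s) *: u) - N (z t - N (z t) *: u)| +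
      `|N (z s) - N (z t)|.
    rewrite (_ : G s - G t = (N (z s - N (z s) *: u) - N (z t - N (z t) *: u)) -
      (N (z s) - N (z t))); first exact: ler_normB.
    by rewrite /G; ring.
  have := norm_lip hN (z s - N (z s) *: u) (z t - N (z t) *: u).
  have : N ((z s - N (z s) *: u) - (z t - N (z t) *: u)) <=
      1 * N (z s - z t) + `|N (z s) - N (z t)| * N u.
    rewrite -(normZ hN) mul1r (_ : _ - _ = (z s - z t) +
      - ((N (z s) - N (z t)) *: u)); last by vec.
    by apply: (le_trans (normD hN _ _)); rewrite (normN hN).
  have := zlip s t; have := Nlip s t; rewrite u1; lra.
have zm1 : z (-1) = u by rewrite /z normrN normr1; vec.
have z1 : z 1 = - u by rewrite /z normr1; vec.
have Gm1 : G (-1) = -1.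
  by rewrite /G zm1 u1 scale1r subrr (norm0 hN); lra.
have G1 : G 1 = 1.
  rewrite /G z1 (normN hN) u1 (_ : - u - 1 *: u = (-2) *: u); last by vec.
  by rewrite (normZ hN) u1 normrN ger0_norm; lra.
have [|||c] := @IVT R G (-1) 1 0.
- lra.
- exact/continuous_subspaceT/(lipschitz_continuous Glip).
- by rewrite Gm1 G1 ge_min le_max ler01 lerN10 orbT.
rewrite in_itv /= => /andP[c1 c2] Gc.
have cn : `|c| < 1.
  rewrite ltr_norml !lt_neqAle c1 c2 !andbT; apply/andP; split.
  - by apply/eqP => cm1; move: Gc; rewrite -cm1 Gm1; lra.
  - by apply/eqP => cm1; move: Gc; rewrite cm1 G1; lra.
have Nz : 0 < N (z c).
  apply: (norm_gt0 hN) => // z0; have [_] := ind _ _ z0; lra.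
exists ((N (z c))^-1 *: z c); split; last first.
  exists ((N (z c))^-1 * - c), ((N (z c))^-1 * (1 - `|c|)); split.
    by rewrite mulr_gt0 ?invr_gt0 //; lra.
  by rewrite /z; vec.
have inv0 : 0 <= (N (z c))^-1 by rewrite invr_ge0 ltW.
split=> //.
  by rewrite (normZ hN) ger0_norm // mulVf // gt_eqF.
have -> : (N (z c))^-1 *: z c - u = (N (z c))^-1 *: (z c - N (z c) *: u).
  by rewrite scalerBr scalerA mulVf ?scale1r // gt_eqF.
rewrite (normZ hN) ger0_norm //.
have -> : N (z c - N (z c) *: u) = N (z c) by move: Gc; rewrite /G; lra.
by rewrite mulVf // gt_eqF.
Qed.

Lemma dot_gt0 n : n <> 0 -> 0 < dot n n.
Proof.
move=> n0; rewrite lt_def dotE; apply/andP; split; last by nra.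
apply/eqP => h; apply: n0; apply: rV2P; rewrite mxE;
  by apply/eqP; rewrite -sqrf_eq0 expr2; apply/eqP; nra.
Qed.

Lemma hex_side u n : N u = 1 -> dot u n = 0 -> n <> 0 ->
  exists v, hex N u v /\ 0 < dot v n.
Proof.
move=> u1 un n0; have nn := dot_gt0 n0.
have [a b e|v [h [a [b [b0 ev]]]]] := @hex_exists u n u1.
  have b0 : b = 0.
    have : dot (a *: u + b *: n) n = 0 by rewrite e dotE !mxE; ring.
    by rewrite dot_lin un => h; apply/eqP; apply: contraTT isT => b0; nra.
  split=> //; move: e; rewrite b0 scale0r addr0 => e.
  by have := normZ hN a u; rewrite e (norm0 hN) u1 mulr1 => /esym/eqP;
     rewrite normr_eq0 => /eqP.
exists v; split=> //; rewrite ev dot_lin un mulr0 add0r.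
exact: mulr_gt0.
Qed.

Definition perp n : 'rV[R]_2 := \row_j if j == 0 then - n 0 1 else n 0 0.

Lemma dot_perp n : dot (perp n) n = 0.
Proof. by rewrite dotE !mxE /=; ring. Qed.

Lemma perp_neq0 n : n <> 0 -> perp n <> 0.
Proof.
move=> n0 p0; apply: n0.
have h0 : perp n 0 0 = 0 by rewrite p0 mxE.
have h1 : perp n 0 1 = 0 by rewrite p0 mxE.
by apply: rV2P; move: h0 h1; rewrite !mxE /= => /eqP + ?;
  rewrite oppr_eq0 => /eqP.
Qed.

(** With [u] on the boundary line of the half plane, three of the six cones of the hexagon fill
    it. *)
Lemma hex_half n : n <> 0 ->
  exists u v, [/\ hex N u v, dot u n = 0 & 0 < dot v n].
Proof.
move=> n0; have p0 := norm_gt0 hN (perp_neq0 n0).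
pose u := (N (perp n))^-1 *: perp n.
have un : dot u n = 0.
  by rewrite /u -[X in dot X _]addr0 -(scale0r 0) dot_lin dot_perp; ring.
have u1 : N u = 1.
  by rewrite (normZ hN) ger0_norm ?invr_ge0 ?(ltW p0) // mulVf // gt_eqF.
by have [v [h vn]] := hex_side u1 un n0; exists u, v.
Qed.

Lemma hex_through u : N u = 1 -> exists v, hex N u v.
Proof.
move=> u1; have u0 : u <> 0.
  by move=> u0; move: u1; rewrite u0 (norm0 hN) => /eqP; rewrite eq_sym oner_eq0.
have un : dot u (perp u) = 0 by rewrite dotE !mxE /=; ring.
by have [v [h _]] := hex_side u1 un (perp_neq0 u0); exists v.
Qed.

End Extremes.

(** * Packings on the unit circle *)

(** A pigeonhole certificate: [n] cells, possibly overlapping, cover [V] and each holds at most one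
    point of it. [atmost_cons] peels off one cell at a time, so later cells only have to treat what
    the earlier ones left. *)
Definition atmost (T : Type) (V : set T) (n : nat) := exists K : nat -> set T,
  (forall z, V z -> exists2 i, (i < n)%N & K i z) /\
  (forall i z w, V z -> V w -> K i z -> K i w -> z = w).

Lemma atmost0 (T : Type) (V : set T) : (forall z, ~ V z) -> atmost V 0.
Proof. by move=> V0; exists (fun=> set0); split=> // z /V0. Qed.

Lemma atmost_cons (T : Type) (V K : set T) n :
  (forall z w, V z -> V w -> K z -> K w -> z = w) ->
  atmost [set z | V z /\ ~ K z] n -> atmost V n.+1.
Proof.
move=> uK [L [cov un]].
exists (fun i => if i is j.+1 then L j `\` K else K); split.
  move=> z Vz; have [Kz|nKz] := pselect (K z); first by exists 0%N.
  by have [i i_n Liz] := cov z (conj Vz nKz); exists i.+1.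
case=> [|i] z w Vz Vw; first exact: uK.
by move=> [Lz nKz] [Lw nKw]; apply: (un i).
Qed.

Lemma atmost_card (T : Type) (V : set T) n : atmost V n -> V #<= `I_n.
Proof.
move=> [K [cov un]]; pose f z := xget 0%N [set i | (i < n)%N /\ K i z].
have fP z : V z -> (f z < n)%N /\ K (f z) z.
  move=> Vz; have [i i_n Ki] := cov z Vz.
  by apply: (@xgetI _ 0%N [set i | (i < n)%N /\ K i z] i).
have inj : {in V &, injective f}.
  move=> z w; rewrite !inE => Vz Vw fzw.
  have [_ Kz] := fP z Vz; have [_ Kw] := fP w Vw.
  by apply: (un (f z)) => //; rewrite fzw.
rewrite -(card_le_eql (inj_card_eq inj)).
by apply: subset_card_le => _ [z Vz <-]; have [] := fP z Vz.
Qed.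

(** * Upper bounds in the whole plane when the ball is not a parallelogram *)

Section UpperBounds.
Variables (R : realType) (N : 'rV[R]_2 -> R) (hN : is_norm N).
Implicit Types (u v w x y z e p q m n : 'rV[R]_2) (a b c d t : R).
Implicit Type V : set 'rV[R]_2.

Definition packing V := (forall v, V v -> N v = 1) /\
  (forall v w, V v -> V w -> v <> w -> 1 <= N (v - w)).

Definition strict_packing V := (forall v, V v -> N v = 1) /\
  (forall v w, V v -> V w -> v <> w -> 1 < N (v - w)).

(* By [hex_square], this says that the unit ball is not a parallelogram. *)
Definition nonsquare := forall u v, hex N u v -> 1 < N (u + v).

Definition long_face := exists x y,
  (forall t, 0 <= t <= 1 -> N ((1 - t) *: x + t *: y) = 1) /\ 1 < N (y - x).

Lemma line_long_face x e p m q a c b :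
  p = x + a *: e -> m = x + c *: e -> q = x + b *: e -> a < c -> c < b ->
  N p = 1 -> N q = 1 -> N m = 1 -> N e = 1 -> 1 < b - a -> long_face.
Proof.
move=> ep em eq ac cb p1 q1 m1 e1 ab.
have sup : forall s t : R, `|s| <= N (s *: x + t *: e).
  by apply: (face_support hN ep em eq); rewrite ?p1 ?q1 ?m1.
exists p, q; split; last first.
  rewrite (_ : q - p = (b - a) *: e); last by rewrite ep eq; vec.
  by rewrite (normZ hN) e1 mulr1 ger0_norm //; lra.
move=> t /andP[t0 t1]; apply/eqP; rewrite eq_le; apply/andP; split.
  have : N ((1 - t) *: p + t *: q) <= (1 - t) * N p + t * N q.
    by apply: (norm_comb hN) => //; lra.
  by rewrite p1 q1; lra.
have -> : (1 - t) *: p + t *: q = 1 *: x + ((1 - t) * a + t * b) *: e.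
  by rewrite ep eq; vec.
by rewrite -[X in X <= _]normr1.
Qed.

(** Otherwise the segment from [v - u] to [v + t *: u] would be in the boundary, with length
    [1 + t]. *)
Lemma no_long_face_hex u v t : ~ long_face -> hex N u v -> 0 < t ->
  N (v + t *: u) <> 1.
Proof.
move=> nlf [u1 v1 d1] t0 Nt; apply: nlf.
apply: (@line_long_face v u (v - u) v (v + t *: u) (-1) 0 t) => //;
  first [by vec | lra].
Qed.

Lemma no_long_face_nonsquare : ~ long_face -> nonsquare.
Proof.
move=> nlf u v h; rewrite lt_neqAle (hex_add_ge1 hN h) andbT.
apply/eqP => /esym; rewrite addrC -[u]scale1r.
exact: (no_long_face_hex nlf h ltr01).
Qed.

(** Half-openness removes [v], and with it most equality cases of [sector_far]; [nonsquare] removes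
    the parallelogram case. Only the pair [u], [v + t *: u] with [t > 0] survives, which the last
    hypothesis forbids. *)
Lemma cell_unique V u v : packing V -> nonsquare -> hex N u v ->
  (forall t, 0 < t -> V u -> V (v + t *: u) -> False) ->
  forall z w, V z -> V w -> hcone u v z -> hcone u v w -> z = w.
Proof.
move=> [V1 Vd] ns h bad z w Vz Vw hz hw.
have [//|zw] := pselect (z = w).
have zv := hcone_neqr hN h hz; have wv := hcone_neqr hN h hw.
have := sector_far hN h (hcone_cone hz) (hcone_cone hw) (V1 _ Vz) (V1 _ Vw)
  (Vd _ _ Vz Vw zw).
case=> [|[t t0]]; first by move=> ?; exfalso; have := ns _ _ h; lra.
have [->|tn0] := eqVneq t 0; last first.
  case=> -[e1 e2] //; exfalso;
    (apply: (bad t); [lra|by rewrite -e1|by rewrite -e2]).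
by rewrite !scale0r !addr0 => -[] [e1 e2].
Qed.

Lemma scale_unit u z c : N u = 1 -> N z = 1 -> 0 <= c -> z = c *: u -> z = u.
Proof.
move=> u1 z1 c0 zE; move: z1; rewrite zE (normZ hN) u1 mulr1 ger0_norm //.
by move=> ->; rewrite scale1r.
Qed.

Lemma cover_upper u v z a b : z = a *: u + b *: v -> 0 <= b -> z <> 0 ->
  [\/ hcone u v z, hcone v (v - u) z, hcone (v - u) (- u) z |
      exists2 c, 0 < c & z = c *: - u].
Proof.
move=> ez b0 z0; have [a0|a0] := ltP 0 a.
  by apply: Or41; exists a, b.
have [ab|ab] := ltP 0 (a + b).
  apply: Or42; exists (a + b), (- a); split; [by []|lra|].
  by rewrite ez; vec.
have [bp|bn] := ltP 0 b.
  apply: Or43; exists b, (- (a + b)); split; [by []|lra|].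
  by rewrite ez; vec.
have b00 : b = 0 by lra.
apply: Or44; exists (- a); last by rewrite ez b00; vec.
rewrite lt_neqAle; apply/andP; split; last lra.
apply/eqP => a00; apply: z0; rewrite ez b00 (_ : a = 0); last lra.
by rewrite !scale0r addr0.
Qed.

Lemma cover_all u v z : hex N u v -> z <> 0 ->
  [\/ hcone u v z, hcone v (v - u) z, hcone (v - u) (- u) z |
   [\/ hcone (- u) (- v) z, hcone (- v) (- (v - u)) z |
       hcone (- (v - u)) u z]].
Proof.
move=> h z0; have [a [b ez]] := indep_span (hex_indep hN h) z.
have [b0|b0] := leP 0 b.
  have [?|?|?|[c c0 ->]] := cover_upper ez b0 z0.
  - exact: Or41.
  - exact: Or42.
  - exact: Or43.
  - by apply: Or44; apply: Or31; exists c, 0; split=> //; vec.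
have ez' : z = (- a) *: - u + (- b) *: - v by rewrite ez; vec.
have nb : 0 <= - b by lra.
have [?|k|k|[c c0 ->]] := cover_upper ez' nb z0.
- by apply: Or44; apply: Or31.
- by apply: Or44; apply: Or32; rewrite opprD.
- by apply: Or44; apply: Or33; move: k; rewrite opprD opprK.
- by apply: Or41; exists c, 0; split=> //; vec.
Qed.

Lemma packing_neq0 V z : packing V -> V z -> z <> 0.
Proof.
by move=> [V1 _] /V1 Nz z0; move: Nz; rewrite z0 (norm0 hN); lra.
Qed.

(** The six half-open cones are the cells. Three conditions suffice, because the bad pairs of
    opposite cones are negatives of each other. *)
Lemma atmost_six_of_hex V u v : packing V -> nonsquare -> hex N u v ->
  (forall t, 0 < t -> N (v + t *: u) <> 1) ->
  (forall t, 0 < t -> N (v - u + t *: v) <> 1) ->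
  (forall t, 0 < t -> N (- u + t *: (v - u)) <> 1) -> atmost V 6.
Proof.
move=> pV ns h g0 g1 g2; have h1 := hex_rot hN h; have h2 := hex_rot hN h1.
have e2 : v - u - v = - u by vec.
rewrite e2 in h2.
have uniq p q : hex N p q -> (forall t, 0 < t -> N (q + t *: p) <> 1) ->
    forall z w, V z -> V w -> hcone p q z -> hcone p q w -> z = w.
  move=> hpq gpq; apply: cell_unique => // t t0 _ Vt.
  by apply: (gpq t t0); have [V1 _] := pV; exact: V1.
have opp p q : (forall t, 0 < t -> N (q + t *: p) <> 1) ->
    forall t, 0 < t -> N (- q + t *: - p) <> 1.
  by move=> g t t0; rewrite scalerN -opprD (normN hN); apply: g.
have h5 : hex N (- (v - u)) u by have := hex_opp hN h2; rewrite opprK.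
have g5 t : 0 < t -> N (u + t *: - (v - u)) <> 1.
  by move=> t0; have := opp _ _ g2 t t0; rewrite opprK.
apply: (@atmost_cons _ _ (hcone u v)); first exact: uniq.
apply: (@atmost_cons _ _ (hcone v (v - u))).
  by move=> z w [Vz _] [Vw _]; apply: uniq.
apply: (@atmost_cons _ _ (hcone (v - u) (- u))).
  by move=> z w [[Vz _] _] [[Vw _] _]; apply: uniq.
apply: (@atmost_cons _ _ (hcone (- u) (- v))).
  move=> z w [[[Vz _] _] _] [[[Vw _] _] _]; apply: uniq => //.
    exact: hex_opp.
  exact: opp.
apply: (@atmost_cons _ _ (hcone (- v) (- (v - u)))).
  move=> z w [[[[Vz _] _] _] _] [[[[Vw _] _] _] _]; apply: uniq => //.
    exact: hex_opp.
  exact: opp.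
apply: (@atmost_cons _ _ (hcone (- (v - u)) u)).
  by move=> z w [[[[[Vz _] _] _] _] _] [[[[[Vw _] _] _] _] _]; apply: uniq.
apply: atmost0 => z [[[[[[Vz n0] n1] n2] n3] n4] n5].
by case: (cover_all h (packing_neq0 pV Vz)) => // -[].
Qed.

(** A long face is prolonged both ways by [chord_end]; [x] and [x + l *: e] are the ends of the
    resulting maximal segment. *)
Lemma long_face_max : long_face -> exists x e l,
  [/\ N e = 1, 1 < l, forall c, 0 <= c <= l -> N (x + c *: e) = 1,
      forall a b, `|a| <= N (a *: x + b *: e) &
      (forall d, l < d -> 1 < N (x + d *: e)) /\
      (forall d, 0 < d -> 1 < N (x - d *: e))].
Proof.
move=> [x [y [xy1 L1]]]; set L := N (y - x) in L1.
have L0 : L != 0 by rewrite gt_eqF //; lra.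
pose e := L^-1 *: (y - x).
have e1 : N e = 1.
  by rewrite (normZ hN) ger0_norm ?invr_ge0 ?mulVf //; rewrite -/L; lra.
have ye : y = x + L *: e by rewrite /e scalerA mulfV // scale1r; vec.
have seg c : 0 <= c <= L -> N (x + c *: e) = 1.
  move=> /andP[c0 cL]; rewrite -(xy1 (c / L)).
    by congr N; rewrite ye; vecf.
  by rewrite divr_ge0 ?ler_pdivrMr ?mul1r //; lra.
have sup a b : `|a| <= N (a *: x + b *: e).
  apply: (@face_support _ _ hN x e x (x + 1 *: e) (x + L *: e) 0 1 L) => //;
    first [by vec | lra | idtac].
  - by rewrite -[x]addr0 -(scale0r e) seg //; lra.
  - by rewrite seg //; lra.
  - by rewrite seg //; lra.
have [||c1 [c10 Nc1 out1]] := @chord_end _ _ hN (x + L *: e) e => //.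
  by rewrite seg //; lra.
have [||c2 [c20 Nc2 out2]] := @chord_end _ _ hN x (- e).
- by rewrite -[x]addr0 -(scale0r e) seg //; lra.
- by rewrite (normN hN).
exists (x - c2 *: e), e, (c2 + L + c1); split=> //; first lra.
- move=> c /andP[cc0 ccl]; apply/eqP; rewrite eq_le; apply/andP; split.
    have : (c2 + L + c1) * N (x - c2 *: e + c *: e) <=
        (c2 + L + c1 - c) * N (x + c2 *: - e) + c * N (x + L *: e + c1 *: e).
      rewrite -[X in X * _]ger0_norm; last lra.
      by rewrite -(normZ hN); apply: (norm_comb hN); [lra|lra|vec].
    by rewrite Nc1 Nc2; nra.
  rewrite (_ : _ + _ = 1 *: x + (c - c2) *: e); last by vec.
  by rewrite -[X in X <= _]normr1.
- move=> a b; rewrite (_ : _ + _ = a *: x + (b - a * c2) *: e) //; by vec.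
- split=> d d0.
    have := out1 (d - c2 - L) ltac:(lra); congr (_ < N _); by vec.
  have := out2 (d + c2) ltac:(lra); congr (_ < N _); by vec.
Qed.

(** Without a long face every hexagon satisfies [atmost_six_of_hex]. Otherwise let [y = x + l *: e]
    be the second end of a maximal face. The hexagons through [y], [y - e], [- e] and through [x],
    [x + e], [e] can each violate only one of the three conditions, the others being secured by the
    supporting line and the ends of the face; they do not both fail. *)
Lemma nonsquare_atmost_six V : packing V -> nonsquare -> atmost V 6.
Proof.
move=> pV ns; have [lf|nlf] := pselect long_face; last first.
  have n0 : (const_mx 1 : 'rV[R]_2) <> 0.
    by move=> /rowP/(_ 0); rewrite !mxE => /eqP; rewrite oner_eq0.
  have [u [v [h _ _]]] := hex_half hN n0.
  have h1 := hex_rot hN h; have h2 := hex_rot hN h1.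
  have e2 : v - u - v = - u by vec.
  rewrite e2 in h2.
  by apply: (atmost_six_of_hex pV ns h) => t; apply: no_long_face_hex.
have [x [e [l [e1 l1 seg sup [endy endx]]]]] := long_face_max lf.
have x1 : N x = 1.
  by have := seg 0; rewrite scale0r addr0 => ->; rewrite ?lexx //=; lra.
have supgt a b z : z = a *: x + b *: e -> 1 < a -> N z <> 1.
  by move=> -> a1; have := sup a b; rewrite ger0_norm; lra.
(* For [l >= 2] the hexagon on [e] and [x + e] would have the sum of these two vertices on the
   face. *)
have l2 : l < 2.
  rewrite ltNge; apply/negP => l2.
  have hx : hex N e (x + e).
    have := seg 1; rewrite scale1r => H.
    by split; rewrite ?addrK // H //; lra.
  have := ns _ _ hx; rewrite (_ : e + _ = x + 2 *: e); last by vec.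
  by rewrite seg //; lra.
have good1 : (forall t, 0 < t -> N (- e + t *: (x + l *: e - e)) <> 1) ->
    atmost V 6.
  move=> g; have ny : N (x + l *: e - e) = 1.
    by rewrite (_ : _ - e = x + (l - 1) *: e) ?seg //; [lra|vec].
  have ed : x + l *: e - e - (x + l *: e) = - e by vec.
  apply: (@atmost_six_of_hex V (x + l *: e) (x + l *: e - e)) => //.
  - by split; rewrite ?ed ?(normN hN) ?seg //; lra.
  - move=> t t0; apply: (supgt (1 + t) (l - 1 + t * l)); last lra.
    by vec.
  - by rewrite ed.
  - move=> t t0; rewrite ed => Nt; have := endy (l + t) ltac:(lra).
    rewrite -(normN hN) (_ : - (x + _) = - (x + l *: e) + t *: - e) ?Nt; last by vec.
    lra.
have good2 : (forall t, 0 < t -> N (e + t *: (x + e)) <> 1) -> atmost V 6.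
  move=> g; have ed : x + e - x = e by vec.
  have := seg 1; rewrite scale1r => Nxe.
  apply: (@atmost_six_of_hex V x (x + e)) => //.
  - by split; rewrite ?ed // Nxe //; lra.
  - move=> t t0; apply: (supgt (1 + t) 1); [by vec|lra].
  - by rewrite ed.
  - move=> t t0; rewrite ed => Nt; have := endx t t0.
    by rewrite -(normN hN) (_ : - (x - _) = - x + t *: e) ?Nt; [lra|vec].
have [/good1 //|/existsNP[t /not_implyP[t0 /contrapT Nt]]] :=
  pselect (forall t, 0 < t -> N (- e + t *: (x + l *: e - e)) <> 1).
apply: good2 => s s0 Ns; exfalso.
(* Failure of the first hexagon puts three unit vectors on the line through [e] and [x + l *: e],
   which therefore supports the ball. Failure of the second gives the unit vector
   [e + s *: (x + e)], beyond this line because [l < 2]. *)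
have sup2 : `|1 + s * (2 - l)| <= N ((1 + s * (2 - l)) *: e + s *: (x + l *: e - e)).
  apply: (@face_support _ _ hN e (x + l *: e - e) (e - t *: (x + l *: e - e)) e
    (x + l *: e) (- t) 0 1); rewrite ?e1 ?seg //;
    first [by vec | lra | idtac].
  by rewrite -(normN hN) opprB addrC Nt.
move: sup2; have -> : (1 + s * (2 - l)) *: e + s *: (x + l *: e - e) =
  e + s *: (x + e) by vec.
by rewrite Ns ger0_norm; nra.
Qed.

End UpperBounds.

(** * Upper bounds in half planes, and for strict packings in the plane *)

Section HalfPlaneBounds.
Variables (R : realType) (N : 'rV[R]_2 -> R) (hN : is_norm N).
Implicit Types (u v w x y z e p q m n : 'rV[R]_2) (a b c d t : R).
Implicit Type V : set 'rV[R]_2.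

Lemma half_coord u v n z : hex N u v -> dot u n = 0 ->
  exists a b, z = a *: u + b *: v /\ dot z n = b * dot v n.
Proof.
move=> h un; have [a [b ez]] := indep_span (hex_indep hN h) z.
by exists a, b; split=> //; rewrite ez dot_lin un mulr0 add0r.
Qed.

Lemma hcone_swap u v z : hcone u v z -> hcone v u z \/ exists2 c, 0 < c & z = c *: u.
Proof.
move=> [a [b [a0 b0 ez]]]; have [b00|bn0] := eqVneq b 0.
  by right; exists a => //; rewrite ez b00 scale0r addr0.
left; exists b, a; split; [by rewrite lt_neqAle eq_sym bn0|exact: ltW|].
by rewrite ez addrC.
Qed.

(** With [u] on the boundary line, the cells [u, v), [v, v - u), [v - u, - u) and the point [- u]
    cover the unit vectors of the half plane. Pushing [v] rightmost frees the first cell of bad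
    pairs. A bad pair in another cell restricts [V] enough for a different choice of four cells. *)
Lemma nonsquare_atmost_four V n : packing N V -> nonsquare N -> n <> 0 ->
  (forall z, V z -> 0 <= dot z n) -> atmost V 4.
Proof.
move=> pV ns n0 Vn; have [V1 Vd] := pV.
have [u [v0 [h0 un v0n]]] := hex_half hN n0.
have [c [c0 h out]] := hex_rightmost hN h0.
have vn : 0 < dot (v0 + c *: u) n.
  by rewrite -[v0]scale1r dot_lin un; lra.
move: (v0 + c *: u) h out vn => v h out vn {v0 c c0 h0 v0n}.
have [u1 v1 d1] := h.
have h1 := hex_rot hN h; have h2 := hex_rot hN h1.
have e2 : v - u - v = - u by vec.
rewrite e2 in h2.
have h2' := hex_sym hN h2; have h1' := hex_sym hN h1.
have nu1 : N (- u) = 1 by rewrite (normN hN).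
have lt1 p q t : hex N p q -> V (q + t *: p) -> t < 1.
  by move=> hpq /V1 Nt; apply: (hex_line_lt1 hN hpq (ns _ _ hpq)); rewrite Nt.
have far z w t p : V z -> V w -> 0 < t -> z - w = t *: p -> N p = 1 -> 1 <= t.
  move=> Vz Vw t0 e p1; have : N (z - w) = t.
    by rewrite e (normZ hN) p1 mulr1 ger0_norm ?ltW.
  move=> <-; apply: Vd => // zw; move: e; rewrite zw subrr => /esym e.
  by move: (normZ hN t p); rewrite e (norm0 hN) p1 ger0_norm ?ltW //; lra.
have uniq0 : forall z w, V z -> V w -> hcone u v z -> hcone u v w -> z = w.
  apply: (cell_unique hN pV ns h) => t t0 _ /V1 Nt.
  by have := out t t0; rewrite Nt; lra.
have cov z : V z -> [\/ hcone u v z, hcone v (v - u) z,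
    hcone (v - u) (- u) z | z = - u].
  move=> Vz; have [a [b [ez zn]]] := half_coord z h un.
  have b0 : 0 <= b by have := Vn z Vz; rewrite zn pmulr_lge0.
  have [k|k|k|[c' c0 k]] := cover_upper ez b0 (packing_neq0 hN pV Vz).
  - exact: Or41.
  - exact: Or42.
  - exact: Or43.
  - by apply: Or44; apply: (scale_unit hN nu1 (V1 _ Vz) (ltW c0) k).
(* The third cell has a bad pair. As [t < 1], the point [- u] is too close to [- u + t *: (v - u)]
   to be in [V]; so [v - u] becomes a cell of its own, and the third cone is used with its other end
   included. The presence of [v - u] also rules out a bad pair in the second cell. *)
have [[t [t0 Vp Vw]]|nE3] :=
    pselect (exists t, [/\ 0 < t, V (v - u) & V (- u + t *: (v - u))]).
  have t1 := lt1 _ _ _ h2 Vw.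
  have nVu : ~ V (- u).
    move=> Vu; have : 1 <= t; last lra.
    by apply: (far _ _ _ _ Vw Vu t0 _ d1); vec.
  apply: (@atmost_cons _ _ (hcone u v)) => //.
  apply: (@atmost_cons _ _ (hcone v (v - u))).
    move=> z w [Vz _] [Vw' _]; apply: (cell_unique hN pV ns h1) => // s s0 _ Vs.
    have s1 := lt1 _ _ _ h1 Vs.
    have : 1 <= s; last lra.
    by apply: (far _ _ _ _ Vs Vp s0 _ v1); vec.
  apply: (@atmost_cons _ _ [set v - u]); first by move=> z w _ _ -> ->.
  apply: (@atmost_cons _ _ (hcone (- u) (v - u))).
    by move=> z w [[[Vz _] _] _] [[[Vw' _] _] _];
      apply: (cell_unique hN pV ns h2').
  apply: atmost0 => z [[[[Vz k0] k1] k2] k3].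
  have [//|//|/hcone_swap[//|[c c0 ez]]|ez] := cov z Vz.
    by apply: k2; apply: (scale_unit hN d1 (V1 _ Vz) (ltW c0) ez).
  by apply: k3; exists 1, 0; split=> //; rewrite ez; vec.
(* The second cell has a bad pair. Now [v - u] is excluded, [v] becomes a cell of its own, and the
   last two cones include their other ends. *)
have [[t [t0 Vv Vw]]|nE2] :=
    pselect (exists t, [/\ 0 < t, V v & V (v - u + t *: v)]).
  have t1 := lt1 _ _ _ h1 Vw.
  have nVp : ~ V (v - u).
    move=> Vp; have : 1 <= t; last lra.
    by apply: (far _ _ _ _ Vw Vp t0 _ v1); vec.
  apply: (@atmost_cons _ _ (hcone u v)) => //.
  apply: (@atmost_cons _ _ [set v]); first by move=> z w _ _ -> ->.
  apply: (@atmost_cons _ _ (hcone (v - u) v)).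
    by move=> z w [[Vz _] _] [[Vw' _] _]; apply: (cell_unique hN pV ns h1').
  apply: (@atmost_cons _ _ (hcone (- u) (v - u))).
    move=> z w [[[Vz _] _] _] [[[Vw' _] _] _].
    apply: (cell_unique hN pV ns h2') => // s s0 _ /V1 Ns.
    (* A bad pair here would make the line through [v - u] and [v] support the ball, while the unit
       vector [v - u + t *: v] lies beyond it. *)
    have : `|1 + t| <= N ((1 + t) *: (v - u) + t *: u).
      apply: (@face_support _ _ hN (v - u) u (v - u + s *: - u) (v - u) v (- s) 0 1);
        rewrite ?v1 ?d1 ?Ns //; first [by vec | lra].
    have -> : (1 + t) *: (v - u) + t *: u = v - u + t *: v by vec.
    by rewrite (V1 _ Vw) ger0_norm; lra.
  apply: atmost0 => z [[[[Vz k0] k1] k2] k3].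
  have [//|/hcone_swap[//|[c c0 ez]]|/hcone_swap[//|[c c0 ez]]|ez] := cov z Vz.
  - by apply: k1; apply: (scale_unit hN v1 (V1 _ Vz) (ltW c0) ez).
  - by apply: k2; exists c, 0; split=> //; rewrite ez; vec.
  - by apply: k3; exists 1, 0; split=> //; rewrite ez; vec.
apply: (@atmost_cons _ _ (hcone u v)) => //.
apply: (@atmost_cons _ _ (hcone v (v - u))).
  move=> z w [Vz _] [Vw' _]; apply: (cell_unique hN pV ns h1) => // s s0 Vv Vs.
  by apply: nE2; exists s.
apply: (@atmost_cons _ _ (hcone (v - u) (- u))).
  move=> z w [[Vz _] _] [[Vw' _] _].
  apply: (cell_unique hN pV ns h2) => // s s0 Vv Vs.
  by apply: nE3; exists s.
apply: (@atmost_cons _ _ [set - u]); first by move=> z w _ _ -> ->.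
apply: atmost0 => z [[[[Vz k0] k1] k2] k3].
by have [] := cov z Vz.
Qed.

(** The cones are half-open on the other side, (u, v], (v, v - u], (v - u, - u]: the omitted ray of
    [u] is on the boundary line, so three cells cover the open half plane. *)
Lemma no_long_face_atmost_three V n : packing N V -> ~ long_face N -> n <> 0 ->
  (forall z, V z -> 0 < dot z n) -> atmost V 3.
Proof.
move=> pV nlf n0 Vn; have [u [v [h un vn]]] := hex_half hN n0.
have ns := no_long_face_nonsquare hN nlf.
have h1 := hex_rot hN h; have h2 := hex_rot hN h1.
have e2 : v - u - v = - u by vec.
rewrite e2 in h2.
have uniq p q : hex N p q ->
    forall z w, V z -> V w -> hcone p q z -> hcone p q w -> z = w.
  move=> hpq; apply: (cell_unique hN pV ns hpq) => t t0 _ Vt.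
  by apply: (no_long_face_hex hN nlf hpq t0); have [V1 _] := pV; exact: V1.
apply: (@atmost_cons _ _ (hcone v u)); first exact: uniq (hex_sym hN h).
apply: (@atmost_cons _ _ (hcone (v - u) v)).
  by move=> z w [Vz _] [Vw _]; apply: uniq (hex_sym hN h1) _ _ _ _.
apply: (@atmost_cons _ _ (hcone (- u) (v - u))).
  by move=> z w [[Vz _] _] [[Vw _] _]; apply: uniq (hex_sym hN h2) _ _ _ _.
apply: atmost0 => z [[[Vz k0] k1] k2].
have [a [b [ez zn]]] := half_coord z h un.
have b0 : 0 < b by have := Vn z Vz; rewrite zn pmulr_lgt0.
have [a0|a0] := leP 0 a.
  by apply: k0; exists b, a; split=> //; rewrite ez addrC.
have [ab|ab] := leP 0 (a + b).
  by apply: k1; exists (- a), (a + b); split=> //; [lra|rewrite ez; vec].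
apply: k2; exists (- (a + b)), b; split; [lra|lra|rewrite ez; vec].
Qed.

(** The hexagon gets a vertex at a point [u] of [V]. Each closed sector holds at most one point, so
    the two sectors at [u] hold only [u], and four others remain. *)
Lemma nonsquare_strict_atmost_five V : strict_packing N V -> nonsquare N ->
  atmost V 5.
Proof.
move=> [V1 Vd] ns; have [[u Vu]|V0] := pselect (exists u, V u); last first.
  by exists (fun=> set0); split=> // z Vz; case: V0; exists z.
have [v h] := hex_through hN (V1 _ Vu).
have h1 := hex_rot hN h; have h2 := hex_rot hN h1.
have e2 : v - u - v = - u by vec.
rewrite e2 in h2.
have uniq p q : hex N p q ->
    forall z w, V z -> V w -> cone p q z -> cone p q w -> z = w.
  move=> hpq z w Vz Vw pz pw; have [//|zw] := pselect (z = w).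
  exfalso; have := sector_le hN hpq pz pw (V1 _ Vz) (V1 _ Vw).
  by have := Vd _ _ Vz Vw zw; lra.
apply: (@atmost_cons _ _ [set u]); first by move=> z w _ _ -> ->.
apply: (@atmost_cons _ _ (cone v (v - u))).
  by move=> z w [Vz _] [Vw _]; apply: uniq.
apply: (@atmost_cons _ _ (cone (v - u) (- u))).
  by move=> z w [[Vz _] _] [[Vw _] _]; apply: uniq.
apply: (@atmost_cons _ _ (cone (- u) (- v))).
  by move=> z w [[[Vz _] _] _] [[[Vw _] _] _]; apply: uniq => //; exact: hex_opp.
apply: (@atmost_cons _ _ (cone (- v) (- (v - u)))).
  move=> z w [[[[Vz _] _] _] _] [[[[Vw _] _] _] _].
  by apply: uniq => //; exact: hex_opp.
apply: atmost0 => z [[[[[Vz k0] k1] k2] k3] k4].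
have z0 : z <> 0 by move=> z0; have := V1 _ Vz; rewrite z0 (norm0 hN); lra.
have cu p : cone u p u by exists 1, 0; split=> //; vec.
have h5 : hex N (- (v - u)) u by have := hex_opp hN h2; rewrite opprK.
case: (cover_all hN h z0) => [k|/hcone_cone //|/hcone_cone //|].
- by apply: k0; apply: (uniq _ _ h) => //; exact: hcone_cone.
- case=> [/hcone_cone //|/hcone_cone //|k].
  by apply: k0; apply: (uniq _ _ h5); [| |exact: hcone_cone|exact: cone_sym].
Qed.

End HalfPlaneBounds.

(** * Upper bounds for parallelogram norms, in coordinates *)

Section Square.
Variables (R : realType) (N : 'rV[R]_2 -> R) (hN : is_norm N).
Implicit Types (u v w x y z e p q m n : 'rV[R]_2) (a b c d t : R).
Implicit Type V : set 'rV[R]_2.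

Definition square_basis u v := indep u v /\
  forall a b, N (a *: u + b *: v) = Num.max `|a| `|b|.

Lemma square_rot u v : square_basis u v -> square_basis v (- u).
Proof.
move=> [ind sq]; split=> [a b e|a b].
  have [] : - b = 0 /\ a = 0; last by lra.
  by apply: ind; rewrite -e; vec.
have -> : a *: v + b *: - u = (- b) *: u + a *: v by vec.
by rewrite sq normrN maxC.
Qed.

Definition box u v (I J : R -> Prop) : set 'rV[R]_2 :=
  [set z | exists a b, [/\ I a, J b & z = a *: u + b *: v]].

Lemma box_dist u v z w a b c d : square_basis u v ->
  z = a *: u + b *: v -> w = c *: u + d *: v ->
  N (z - w) = Num.max `|a - c| `|b - d|.
Proof.
move=> [_ sq] -> ->; rewrite -sq; congr N; vec.
Qed.

Lemma square_atmost_eight V u v : square_basis u v -> packing N V -> atmost V 8.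
Proof.
move=> sb [V1 Vd].
(* The intervals [-1, 0), [0, 1) and the point 1 give nine boxes; the one over [mid] and [mid]
   contains no unit vector. *)
pose lo : R -> Prop := fun a => -1 <= a < 0.
pose mid : R -> Prop := fun a => 0 <= a < 1.
pose hi : R -> Prop := fun a => a = 1.
have small I J : I \in [:: 0; 1; 2]%N -> J \in [:: 0; 1; 2]%N ->
   forall z w, V z -> V w -> box u v (nth hi [:: lo; mid; hi] I) (nth hi [:: lo; mid; hi] J) z ->
   box u v (nth hi [:: lo; mid; hi] I) (nth hi [:: lo; mid; hi] J) w -> z = w.
  have close I' : I' \in [:: 0; 1; 2]%N -> forall a c,
      nth hi [:: lo; mid; hi] I' a -> nth hi [:: lo; mid; hi] I' c -> `|a - c| < 1.
    by rewrite !inE => /or3P[] /eqP-> a c /=; rewrite /lo /mid /hi ltr_norml;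
      [move=> /andP[? ?] /andP[? ?]|move=> /andP[? ?] /andP[? ?]|move=> -> ->];
      lra.
  move=> hI hJ z w Vz Vw [a [b [Ia Jb ez]]] [c [d [Ic Jd ew]]].
  have [//|zw] := pselect (z = w); exfalso.
  have := Vd _ _ Vz Vw zw; rewrite (box_dist sb ez ew) leNgt gt_max.
  by rewrite (close I) ?(close J).
have cov a : `|a| <= 1 -> [\/ lo a, mid a | hi a].
  rewrite ler_norml => /andP[a1 a2]; have [a0|a0] := ltP a 0.
    by apply: Or31; rewrite /lo a1 a0.
  have [a3|a3] := ltP a 1; first by apply: Or32; rewrite /mid a0 a3.
  by apply: Or33; rewrite /hi; lra.
apply: (@atmost_cons _ _ (box u v lo lo)); first exact: (small 0%N 0%N).
apply: (@atmost_cons _ _ (box u v lo mid)).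
  by move=> z w [Vz _] [Vw _]; apply: (small 0%N 1%N).
apply: (@atmost_cons _ _ (box u v lo hi)).
  by move=> z w [[Vz _] _] [[Vw _] _]; apply: (small 0%N 2%N).
apply: (@atmost_cons _ _ (box u v mid lo)).
  by move=> z w [[[Vz _] _] _] [[[Vw _] _] _]; apply: (small 1%N 0%N).
apply: (@atmost_cons _ _ (box u v mid hi)).
  by move=> z w [[[[Vz _] _] _] _] [[[[Vw _] _] _] _]; apply: (small 1%N 2%N).
apply: (@atmost_cons _ _ (box u v hi lo)).
  move=> z w [[[[[Vz _] _] _] _] _] [[[[[Vw _] _] _] _] _].
  exact: (small 2%N 0%N).
apply: (@atmost_cons _ _ (box u v hi mid)).
  move=> z w [[[[[[Vz _] _] _] _] _] _] [[[[[[Vw _] _] _] _] _] _].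
  exact: (small 2%N 1%N).
apply: (@atmost_cons _ _ (box u v hi hi)).
  move=> z w [[[[[[[Vz _] _] _] _] _] _] _] [[[[[[[Vw _] _] _] _] _] _] _].
  exact: (small 2%N 2%N).
apply: atmost0 => z [[[[[[[[Vz k1] k2] k3] k4] k5] k6] k7] k8].
have [ind sq] := sb; have [a [b ez]] := indep_span ind z.
have := V1 _ Vz; rewrite ez sq => m1.
have a1 : `|a| <= 1 by rewrite -m1 le_max lexx.
have b1 : `|b| <= 1 by rewrite -m1 le_max lexx orbT.
case: (cov a a1) => Ha; case: (cov b b1) => Hb;
  [apply: k1|apply: k2|apply: k3|apply: k4|idtac|apply: k5|apply: k6|apply: k7|
   apply: k8]; try by exists a, b.
move: Ha Hb m1 => /andP[? ?] /andP[? ?] m1.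
have : Num.max `|a| `|b| < 1 by rewrite gt_max !ltr_norml; lra.
by rewrite m1 ltxx.
Qed.

Lemma square_strict_atmost_four V u v : square_basis u v -> strict_packing N V ->
  atmost V 4.
Proof.
move=> sb [V1 Vd].
pose neg : R -> Prop := fun a => -1 <= a <= 0.
pose pos : R -> Prop := fun a => 0 <= a <= 1.
have small I J : (I = neg \/ I = pos) -> (J = neg \/ J = pos) ->
   forall z w, V z -> V w -> box u v I J z -> box u v I J w -> z = w.
  have close I' : (I' = neg \/ I' = pos) -> forall a c,
      I' a -> I' c -> `|a - c| <= 1.
    by move=> [] -> a c /andP[? ?] /andP[? ?]; rewrite ler_norml; lra.
  move=> hI hJ z w Vz Vw [a [b [Ia Jb ez]]] [c [d [Ic Jd ew]]].
  have [//|zw] := pselect (z = w); exfalso.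
  have := Vd _ _ Vz Vw zw; rewrite (box_dist sb ez ew) ltNge ge_max.
  by rewrite (close I) ?(close J).
have cov a : `|a| <= 1 -> neg a \/ pos a.
  rewrite ler_norml => /andP[a1 a2]; have [a0|a0] := leP a 0.
    by left; rewrite /neg a1 a0.
  by right; rewrite /pos a2 ltW.
apply: (@atmost_cons _ _ (box u v neg neg)).
  by apply: small; auto.
apply: (@atmost_cons _ _ (box u v neg pos)).
  by move=> z w [Vz _] [Vw _]; apply: small; auto.
apply: (@atmost_cons _ _ (box u v pos neg)).
  by move=> z w [[Vz _] _] [[Vw _] _]; apply: small; auto.
apply: (@atmost_cons _ _ (box u v pos pos)).
  by move=> z w [[[Vz _] _] _] [[[Vw _] _] _]; apply: small; auto.
apply: atmost0 => z [[[[Vz k1] k2] k3] k4].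
have [ind sq] := sb; have [a [b ez]] := indep_span ind z.
have := V1 _ Vz; rewrite ez sq => m1.
have a1 : `|a| <= 1 by rewrite -m1 le_max lexx.
have b1 : `|b| <= 1 by rewrite -m1 le_max lexx orbT.
case: (cov a a1) => Ha; case: (cov b b1) => Hb;
  [apply: k1|apply: k2|apply: k3|apply: k4]; by exists a, b.
Qed.

(** Quarter turns of the basis allow [dot v' n] to be the largest of the values of [dot] with [n] at
    the basis vectors and their negatives. Then [t] is the slope of the boundary line, which leaves
    the square through the sides [a = 1] and [a = -1]. *)
Lemma square_orient u v n : square_basis u v -> n <> 0 -> exists u' v',
  square_basis u' v' /\ exists2 t, `|t| <= 1 &
    0 < dot v' n /\ forall a b, dot (a *: u' + b *: v') n = (b - t * a) * dot v' n.
Proof.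
move=> sb n0.
have main u' v' : square_basis u' v' -> 0 < dot v' n ->
    `|dot u' n| <= dot v' n -> exists u' v',
  square_basis u' v' /\ exists2 t, `|t| <= 1 &
    0 < dot v' n /\ forall a b, dot (a *: u' + b *: v') n = (b - t * a) * dot v' n.
  move=> sb' v0 uv; exists u', v'; split=> //; exists (- dot u' n / dot v' n).
    by rewrite normrM normrN normfV (gtr0_norm v0) ler_pdivrMr // mul1r.
  split=> // a b; rewrite dot_lin; field; by rewrite gt_eqF.
have dN x : dot (- x) n = - dot x n by rewrite !dotE !mxE; ring.
have sb1 := square_rot sb; have sb2 := square_rot sb1; have sb3 := square_rot sb2.
rewrite !opprK in sb3.
have nz : dot u n != 0 \/ dot v n != 0.
  have [u0|] := eqVneq (dot u n) 0; last by left.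
  right; apply/eqP => w0; have [ind _] := sb.
  have [a [b en]] := indep_span ind n.
  by have := dot_gt0 n0; rewrite {1}en dot_lin u0 w0; lra.
have [vp|vp] := leP 0 (dot v n); have [up|up] := leP 0 (dot u n);
  have [uv|uv] := leP `|dot u n| `|dot v n|; move: uv;
  rewrite ?(ger0_norm vp) ?(ltr0_norm vp) ?(ger0_norm up) ?(ltr0_norm up) => uv.
- apply: (main u v) => //; last by rewrite ger0_norm.
  by case: nz => /eqP; lra.
- apply: (main (- v) u) => //; first lra.
  by rewrite dN normrN ger0_norm //; lra.
- apply: (main u v) => //; last by rewrite ltr0_norm.
  by case: nz => /eqP; lra.
- apply: (main v (- u)) => //; rewrite ?dN; first lra.
  by rewrite ger0_norm //; lra.
- apply: (main (- u) (- v)) => //; rewrite ?dN; first lra.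
  by rewrite normrN ger0_norm //; lra.
- apply: (main (- v) u) => //; first lra.
  by rewrite dN normrN ltr0_norm //; lra.
- apply: (main (- u) (- v)) => //; rewrite ?dN; first lra.
  by rewrite normrN ltr0_norm //; lra.
- apply: (main v (- u)) => //; rewrite ?dN; first lra.
  by rewrite ltr0_norm //; lra.
Qed.

(* [arc u v t z f]: the boundary point [z] of the square is reached from the
   point [u + t *: v] by a counterclockwise walk of length [f]. *)
Definition arc u v t z f := exists a b, [/\ z = a *: u + b *: v,
  `|a| <= 1, `|b| <= 1 &
  [\/ a = 1 /\ f = b - t, b = 1 /\ f = 2 - t - a | a = -1 /\ f = 4 - t - b]].

Lemma arc_dist u v t z w f g : square_basis u v -> arc u v t z f ->
  arc u v t w g -> N (z - w) <= `|f - g|.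
Proof.
move=> sb [a [b [ez a1 b1 k1]]] [c [d [ew c1 d1 k2]]].
rewrite (box_dist sb ez ew) ge_max !ler_norml.
move: a1 b1 c1 d1; rewrite !ler_norml.
have := ler_norm (f - g); have := lerNnormlW (lexx `|f - g|).
move=> ? ? /andP[? ?] /andP[? ?] /andP[? ?] /andP[? ?].
by case: k1 => -[? ?]; case: k2 => -[? ?]; lra.
Qed.

(** The boundary line meets the square at [(1, t)] and [(- 1, - t)]. The arc between them has length
    4, half of the perimeter, and apart from corners it avoids the side [b = -1]. *)
Lemma square_half u v t a b : `|t| <= 1 -> Num.max `|a| `|b| = 1 -> t * a <= b ->
  exists f, arc u v t (a *: u + b *: v) f /\ 0 <= f <= 4 /\ (t * a < b -> f < 4).
Proof.
move=> t1 m1 tab.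
have a1 : `|a| <= 1 by rewrite -m1 le_max lexx.
have b1 : `|b| <= 1 by rewrite -m1 le_max lexx orbT.
have [ta tb tt] := And3 a1 b1 t1; move: ta tb tt; rewrite !ler_norml.
move=> /andP[? ?] /andP[? ?] /andP[? ?].
have mk f : [\/ a = 1 /\ f = b - t, b = 1 /\ f = 2 - t - a | a = -1 /\ f = 4 - t - b]
    -> arc u v t (a *: u + b *: v) f by move=> H; exists a, b.
have [ea|na1] := eqVneq a 1.
  exists (b - t); split; [by apply: mk; apply: Or31|rewrite ea in tab *; lra].
have [ea|nam] := eqVneq a (-1).
  exists (4 - t - b); split; [by apply: mk; apply: Or33|rewrite ea in tab *; lra].
have [eb|nb1] := eqVneq b 1.
  exists (2 - t - a); split; [by apply: mk; apply: Or32|lra].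
have [eb|nbm] := eqVneq b (-1).
  exfalso; have alt1 : `|a| < 1.
    by rewrite ltr_norml !lt_neqAle na1 [-1 == _]eq_sym nam; lra.
  have : `|t * a| < 1 by rewrite normrM; have := normr_ge0 a; nra.
  by rewrite ltr_norml; lra.
exfalso; have : Num.max `|a| `|b| < 1; last by rewrite m1 ltxx.
by rewrite gt_max !ltr_norml !lt_neqAle na1 nb1 ![-1 == _]eq_sym nam nbm; lra.
Qed.

Lemma arc_unique V u v t c : square_basis u v -> packing N V ->
  forall z w, V z -> V w -> (exists2 f, arc u v t z f & c <= f < c + 1) ->
  (exists2 f, arc u v t w f & c <= f < c + 1) -> z = w.
Proof.
move=> sb [V1 Vd] z w Vz Vw [f zf /andP[? ?]] [g wg /andP[? ?]].
have [//|zw] := pselect (z = w); exfalso.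
have := Vd _ _ Vz Vw zw; have := arc_dist sb zf wg.
have : `|f - g| < 1 by rewrite ltr_norml; lra.
lra.
Qed.

(** The cells are arcs of length 1 without their end points. A fifth one is needed only for the end
    [f = 4], which lies on the boundary line. *)
Lemma square_atmost_half V u v n : square_basis u v -> packing N V -> n <> 0 ->
  ((forall z, V z -> 0 <= dot z n) -> atmost V 5) /\
  ((forall z, V z -> 0 < dot z n) -> atmost V 4).
Proof.
move=> sb0 pV n0; have [u' [v' [sb [t t1 [vn dotn]]]]] := square_orient sb0 n0.
have [V1 Vd] := pV; have [ind sq] := sb.
pose K c : set 'rV[R]_2 := [set z | exists2 f, arc u' v' t z f & c <= f < c + 1].
have uniq c z w : V z -> V w -> K c z -> K c w -> z = w by exact: arc_unique.
have cov z : V z -> 0 <= dot z n ->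
    exists f, [/\ arc u' v' t z f, 0 <= f <= 4 & 0 < dot z n -> f < 4].
  move=> Vz; have [a [b ez]] := indep_span ind z.
  rewrite ez dotn pmulr_lge0 // subr_ge0 => tab.
  have [|f [zf [f04 flt]]] := @square_half u' v' t a b t1 _ tab.
    by rewrite -sq -ez; exact: V1.
  exists f; split=> //; rewrite pmulr_lgt0 // subr_gt0; exact: flt.
split=> Vn; apply: (@atmost_cons _ _ (K 0)); try exact: uniq;
  (apply: (@atmost_cons _ _ (K 1)); first by move=> z w [Vz _] [Vw _]; exact: uniq);
  (apply: (@atmost_cons _ _ (K 2));
    first by move=> z w [[Vz _] _] [[Vw _] _]; exact: uniq);
  (apply: (@atmost_cons _ _ (K 3));
    first by move=> z w [[[Vz _] _] _] [[[Vw _] _] _]; exact: uniq).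
- apply: (@atmost_cons _ _ (K 4)).
    by move=> z w [[[[Vz _] _] _] _] [[[[Vw _] _] _] _]; exact: uniq.
  apply: atmost0 => z [[[[[Vz k0] k1] k2] k3] k4].
  have [f [zf /andP[f0 f4] _]] := cov z Vz (Vn z Vz).
  have [f1|f1] := ltP f 1; first by apply: k0; exists f => //; lra.
  have [f2|f2] := ltP f 2; first by apply: k1; exists f => //; lra.
  have [f3|f3] := ltP f 3; first by apply: k2; exists f => //; lra.
  have [f5|f5] := ltP f 4; first by apply: k3; exists f => //; lra.
  by apply: k4; exists f => //; lra.
- apply: atmost0 => z [[[[Vz k0] k1] k2] k3].
  have [f [zf /andP[f0 f4] lt4]] := cov z Vz (ltW (Vn z Vz)).
  have {}lt4 := lt4 (Vn z Vz).
  have [f1|f1] := ltP f 1; first by apply: k0; exists f => //; lra.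
  have [f2|f2] := ltP f 2; first by apply: k1; exists f => //; lra.
  have [f3|f3] := ltP f 3; first by apply: k2; exists f => //; lra.
  by apply: k3; exists f => //; lra.
Qed.

End Square.

(** * Constructions *)

Section LowerBounds.
Variables (R : realType) (N : 'rV[R]_2 -> R) (hN : is_norm N).
Implicit Types (u v w x y z e p q s n : 'rV[R]_2) (a b c d t tau : R).

Lemma card_seq (T : choiceType) (l : seq T) : uniq l -> [set` l] #= `I_(size l).
Proof.
case: l => [_|x l ul]; first by rewrite (_ : [set` _] = set0) ?II0 //; apply/seteqP; split.
have -> : [set` x :: l] = nth x (x :: l) @` `I_(size (x :: l)).
  apply/seteqP; split=> [y /= /(nthP x)[i il <-]|_ [i il <-] /=]; first by exists i.
  exact: mem_nth.
apply: inj_card_eq => i j; rewrite !inE => il jl /eqP.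
by rewrite nth_uniq // => /eqP.
Qed.

Lemma pairwise_sym (T : eqType) (r : rel T) (l : seq T) : symmetric r ->
  pairwise r l -> forall x y : T, x \in l -> y \in l -> x <> y -> r x y.
Proof.
move=> rs; elim: l => [//|z l IH] /= /andP[/allP zl pl] x y.
rewrite !inE => /predU1P[->|xl] /predU1P[->|yl] xy //.
- exact: zl.
- by rewrite rs; exact: zl.
- exact: IH.
Qed.

Lemma packing_seq (l : seq 'rV[R]_2) : (forall z, z \in l -> N z = 1) ->
  pairwise (fun x y => 1 <= N (x - y)) l ->
  packing N [set` l] /\ [set` l] #= `I_(size l).
Proof.
move=> l1 pl; split.
  split=> // x y xl yl xy; apply: (pairwise_sym _ pl) => // z t.
  by rewrite (normBC hN).
apply: card_seq; apply: (pairwise_uniq _ pl) => x.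
by rewrite subrr (norm0 hN) ler10.
Qed.

Lemma strict_packing_seq (l : seq 'rV[R]_2) : (forall z, z \in l -> N z = 1) ->
  pairwise (fun x y => 1 < N (x - y)) l ->
  strict_packing N [set` l] /\ [set` l] #= `I_(size l).
Proof.
move=> l1 pl; split.
  split=> // x y xl yl xy.
  apply: (@pairwise_sym _ (fun x y => 1 < N (x - y)) _ _ pl) => // z t.
  by rewrite (normBC hN).
apply: card_seq; apply: (pairwise_uniq _ pl) => x.
by rewrite subrr (norm0 hN) ltr10.
Qed.

Lemma norm_eq_pm x z : x = z \/ x = - z -> N x = N z.
Proof. by move=> [] ->; rewrite ?(normN hN). Qed.

(** Up to sign, every difference of two vertices is a vertex, a sum of two neighbouring vertices, or
    twice a vertex. *)
Lemma hex_six_pairwise u v : hex N u v ->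
  pairwise (fun x y => 1 <= N (x - y)) [:: u; v; v - u; - u; - v; u - v].
Proof.
move=> h; have h1 := hex_rot hN h; have h2 := hex_rot hN h1.
have [u1 v1 d1] := h.
have f1 := hex_add_ge1 hN h; have f2 := hex_add_ge1 hN h1.
have f3 := hex_add_ge1 hN h2.
have twice z : N z = 1 -> 1 <= N (2 *: z).
  by move=> z1; rewrite (normZ hN) z1 ger0_norm; lra.
have g1 := twice _ u1; have g2 := twice _ v1; have g3 := twice _ d1.
have k1 : 1 <= N u by rewrite u1. have k2 : 1 <= N v by rewrite v1.
have k3 : 1 <= N (v - u) by rewrite d1.
have tr z x : 1 <= N z -> x = z \/ x = - z -> 1 <= N x.
  by move=> z1 /norm_eq_pm ->.
rewrite /= !andbT; repeat (apply/andP; split);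
  first [ apply: (tr _ _ k1); first [left; vec | right; vec]
        | apply: (tr _ _ k2); first [left; vec | right; vec]
        | apply: (tr _ _ k3); first [left; vec | right; vec]
        | apply: (tr _ _ f1); first [left; vec | right; vec]
        | apply: (tr _ _ f2); first [left; vec | right; vec]
        | apply: (tr _ _ f3); first [left; vec | right; vec]
        | apply: (tr _ _ g1); first [left; vec | right; vec]
        | apply: (tr _ _ g2); first [left; vec | right; vec]
        | apply: (tr _ _ g3); first [left; vec | right; vec] ].
Qed.

Lemma hex_six_unit u v : hex N u v ->
  forall z, z \in [:: u; v; v - u; - u; - v; u - v] -> N z = 1.
Proof.
move=> [u1 v1 d1] z; rewrite !inE => /or4P[/eqP->|/eqP->|/eqP->|/or3P[] /eqP->] //.
- by rewrite (normN hN).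
- by rewrite (normN hN).
- by rewrite (normBC hN).
Qed.

Lemma hex_ex : exists u v, hex N u v.
Proof.
have n0 : (const_mx 1 : 'rV[R]_2) <> 0.
  by move=> /rowP/(_ 0); rewrite !mxE => /eqP; rewrite oner_eq0.
by have [u [v [h _ _]]] := hex_half hN n0; exists u, v.
Qed.

Lemma packing_six : exists V, packing N V /\ V #= `I_6.
Proof.
have [u [v h]] := hex_ex.
exists [set` [:: u; v; v - u; - u; - v; u - v]].
exact: packing_seq (hex_six_unit h) (hex_six_pairwise h).
Qed.

Lemma neq0_of_dot x n a : dot x n = a -> a != 0 -> n <> 0.
Proof. by move=> + /eqP a0 n0; rewrite n0 dotE !mxE => e; apply: a0; rewrite -e; ring. Qed.

Lemma packing_closed_four : exists V, [/\ packing N V, V #= `I_4 &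
  exists2 n, n <> 0 & forall z, V z -> 0 <= dot z n].
Proof.
have [u [v h]] := hex_ex.
have [|| pl cl] := @packing_seq [:: u; v; v - u; - u].
- move=> z zl; apply: (hex_six_unit h).
  by move: zl; rewrite !inE => /or4P[] ->; rewrite ?orbT.
- by move: (hex_six_pairwise h); rewrite /= => /and5P[] /and5P[-> -> -> _ _]
    /and4P[-> -> _ _] /and3P[-> _ _].
exists [set` [:: u; v; v - u; - u]]; split=> //.
have [n [un vn]] := indep_dot 0 1 (hex_indep hN h).
exists n; first by apply: (neq0_of_dot vn); rewrite oner_eq0.
have lin a b : dot (a *: u + b *: v) n = b by rewrite dot_lin un vn; lra.
move=> z /=; rewrite !inE => /or4P[] /eqP->; rewrite ?un ?vn //.
- by rewrite (_ : v - u = (-1) *: u + 1 *: v) ?lin //; vec.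
- by rewrite (_ : - u = (-1) *: u + 0 *: v) ?lin //; vec.
Qed.

Lemma packing_open_three : exists V, [/\ packing N V, V #= `I_3 &
  exists2 n, n <> 0 & forall z, V z -> 0 < dot z n].
Proof.
have [u [v h]] := hex_ex.
have [|| pl cl] := @packing_seq [:: u; v; v - u].
- move=> z zl; apply: (hex_six_unit h).
  by move: zl; rewrite !inE => /or3P[] ->; rewrite ?orbT.
- by move: (hex_six_pairwise h); rewrite /= => /and5P[] /and5P[-> -> _ _ _]
    /and4P[-> _ _ _] _.
exists [set` [:: u; v; v - u]]; split=> //.
have [n [un vn]] := indep_dot 1 2 (hex_indep hN h).
exists n; first by apply: (neq0_of_dot un); rewrite oner_eq0.
move=> z /=; rewrite !inE => /or3P[] /eqP->; rewrite ?un ?vn //; try lra.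
by rewrite (_ : v - u = (-1) *: u + 1 *: v) ?dot_lin ?un ?vn; [lra|vec].
Qed.

(** Take a segment of the boundary from [x] to [x + l *: e] with [l > 1]. All pairs but one differ
    by at least 1 in the [x]-coordinate, which [sup] turns into distance; the remaining difference
    is [e]. *)
Lemma packing_open_four : long_face N -> exists V, [/\ packing N V, V #= `I_4 &
  exists2 n, n <> 0 & forall z, V z -> 0 < dot z n].
Proof.
move=> /(long_face_max hN)[x [e [l [e1 l1 seg sup _]]]].
have ind : indep x e.
  move=> a b eq0; have a0 : a = 0.
    by have := sup a b; rewrite eq0 (norm0 hN) normr_le0 => /eqP.
  split=> //; move: eq0; rewrite a0 scale0r add0r => eq0.
  have := normZ hN b e; rewrite eq0 (norm0 hN) e1 mulr1 => /esym/eqP.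
  by rewrite normr_eq0 => /eqP.
have x1 : N x = 1 by rewrite -(seg 0) ?scale0r ?addr0 //; lra.
have sup' a b z : z = a *: x + b *: e -> 1 <= - a -> 1 <= N z.
  by move=> -> a1; apply: le_trans (sup a b); have := ler_norm (- a); rewrite normrN; lra.
have [|| pl cl] := @packing_seq [:: - x; e; x + l *: e; x + (l - 1) *: e].
- move=> z; rewrite !inE => /or4P[] /eqP->; rewrite ?(normN hN) // seg //; lra.
- rewrite /= !andbT; repeat (apply/andP; split).
  + by apply: (sup' (-1) (-1)); [vec|lra].
  + by apply: (sup' (-2) (- l)); [vec|lra].
  + by apply: (sup' (-2) (1 - l)); [vec|lra].
  + by apply: (sup' (-1) (1 - l)); [vec|lra].
  + by apply: (sup' (-1) (2 - l)); [vec|lra].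
  + by rewrite (_ : _ - _ = e) ?e1 //; vec.
exists [set` [:: - x; e; x + l *: e; x + (l - 1) *: e]]; split=> //.
(* This value at [x] gives [- x] and [x + (l - 1) *: e] the same product [(l - 1) / 2], positive
   since [l > 1]. *)
have [n [xn en]] := indep_dot (- (l - 1) / 2) 1 ind.
exists n; first by apply: (neq0_of_dot en); rewrite oner_eq0.
have lin a b : dot (a *: x + b *: e) n = b - a * (l - 1) / 2.
  by rewrite dot_lin xn en; field.
move=> z /=; rewrite !inE => /or4P[] /eqP->.
- by rewrite (_ : - x = (-1) *: x + 0 *: e) ?lin; [lra|vec].
- by rewrite en.
- by rewrite (_ : x + _ = 1 *: x + l *: e) ?lin; [lra|vec].
- by rewrite (_ : x + _ = 1 *: x + (l - 1) *: e) ?lin; [lra|vec].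
Qed.

(** Integer coordinates reduce the packing conditions of the explicit families to computation. *)
Definition grid u v (i : int * int) := i.1%:~R *: u + i.2%:~R *: v.

Lemma grid_norm u v (k : int) (i : int * int) : square_basis N u v ->
  (k%:~R <= N (grid u v i)) = (k <= `|i.1|) || (k <= `|i.2|).
Proof. by move=> [_ sq]; rewrite sq -!intr_norm le_max !ler_int. Qed.

Lemma grid_unit u v (i : int * int) : square_basis N u v ->
  Num.max `|i.1| `|i.2| == 1 -> N (grid u v i) = 1.
Proof.
move=> [_ sq] /eqP m1; rewrite sq -!intr_norm.
transitivity ((Num.max `|i.1| `|i.2|)%:~R : R); last by rewrite m1.
by rewrite /Order.max ltr_int; case: ifP.
Qed.

Lemma grid_sub u v (i j : int * int) : grid u v i - grid u v j = grid u v (i.1 - j.1, i.2 - j.2).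
Proof. by rewrite /grid /= !intrB; vec. Qed.

Definition grid_far (k : int) (i j : int * int) :=
  (k <= `|i.1 - j.1|) || (k <= `|i.2 - j.2|).

Lemma grid_packing u v (l : seq (int * int)) : square_basis N u v ->
  all (fun i : int * int => Num.max `|i.1| `|i.2| == 1) l -> pairwise (grid_far 1) l ->
  packing N [set` map (grid u v) l] /\ [set` map (grid u v) l] #= `I_(size l).
Proof.
move=> sb /allP l1 pl; rewrite -(size_map (grid u v)); apply: packing_seq.
  by move=> _ /mapP[i /l1 i1 ->]; exact: grid_unit.
rewrite pairwise_map; apply: sub_pairwise pl => i j ij /=.
by rewrite grid_sub (grid_norm 1).
Qed.

Lemma grid_strict_packing u v (l : seq (int * int)) : square_basis N u v ->
  all (fun i : int * int => Num.max `|i.1| `|i.2| == 1) l -> pairwise (grid_far 2) l ->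
  strict_packing N [set` map (grid u v) l] /\ [set` map (grid u v) l] #= `I_(size l).
Proof.
move=> sb /allP l1 pl; rewrite -(size_map (grid u v)); apply: strict_packing_seq.
  by move=> _ /mapP[i /l1 i1 ->]; exact: grid_unit.
rewrite pairwise_map; apply: sub_pairwise pl => i j ij /=.
have : (2%:~R : R) <= N (grid u v i - grid u v j) by rewrite grid_sub grid_norm.
lra.
Qed.

Lemma square_packing_eight u v : square_basis N u v ->
  exists V, packing N V /\ V #= `I_8.
Proof.
move=> sb; eexists; apply: (grid_packing (l := [:: (1, 0); (1, 1); (0, 1);
  (-1, 1); (-1, 0); (-1, -1); (0, -1); (1, -1)]) sb); by [].
Qed.

Lemma square_strict_packing_four u v : square_basis N u v ->
  exists V, strict_packing N V /\ V #= `I_4.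
Proof.
move=> sb; eexists; apply: (grid_strict_packing (l := [:: (1, 1); (-1, 1);
  (-1, -1); (1, -1)]) sb); by [].
Qed.

Lemma square_packing_closed_five u v : square_basis N u v ->
  exists V, [/\ packing N V, V #= `I_5 &
    exists2 n, n <> 0 & forall z, V z -> 0 <= dot z n].
Proof.
move=> sb; have [||pl cl] := grid_packing (l := [:: (1, 0); (1, 1); (0, 1);
  (-1, 1); (-1, 0)]) sb; [by []|by []|].
eexists; split; [exact: pl|exact: cl|].
have [ind _] := sb; have [n [un vn]] := indep_dot 0 1 ind.
exists n; first by apply: (neq0_of_dot vn); rewrite oner_eq0.
move=> z /mapP[i il ->]; rewrite dot_lin un vn mulr0 add0r mulr1 ler0z.
by move: il; rewrite !inE => /or4P[/eqP->|/eqP->|/eqP->|/orP[] /eqP->].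
Qed.

(** [v - d *: w] is normalised by its norm [g], where [1 - d <= g <= 1], so the move is at most
    [2 * d]. The new difference from [w] is [g^-1 *: (v - (d + g) *: w)]: if [d + g > 1],
    leftmostness makes the inner norm exceed 1; if [d + g = 1], it equals 1 while [g < 1]. *)
Lemma leftmost_perturb w v eps : leftmost N w v -> 0 < eps ->
  exists v', [/\ N v' = 1, N (v' - v) < eps & 1 < N (v' - w)].
Proof.
move=> [[w1 v1 d1] out] eps0.
have [d [d0 d12 deps]] : exists d, [/\ 0 < d, d < 1 / 2 & 2 * d < eps].
  have [e1|e1] := leP eps (1 / 2); [exists (eps / 4)|exists (1 / 8)]; split; lra.
set x := v - d *: w; pose g := N x.
have dw : N (d *: w) = d by rewrite (normZ hN) w1 mulr1 ger0_norm // ltW.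
have g1 : g <= 1.
  have : g <= (1 - d) * N v + d * N (v - w).
    by apply: (norm_comb hN); [lra|lra|rewrite /x; vec].
  by rewrite v1 d1; lra.
have gd : 1 - d <= g.
  have : N v <= 1 * N x + 1 * N (d *: w).
    by apply: (norm_comb hN); [lra|lra|rewrite /x; vec].
  by rewrite v1 dw /g; lra.
have g0 : g != 0 by rewrite gt_eqF //; lra.
have ig : 0 < g^-1 by rewrite invr_gt0; lra.
exists (g^-1 *: x); split.
- by rewrite (normZ hN) ger0_norm ?ltW // -/g mulVf.
- have : N (g^-1 *: x - v) <= N ((g^-1 - 1) *: x) + N (- (d *: w)).
    by apply: le_trans (normD hN _ _); rewrite /x le_eqVlt; apply/orP; left;
       apply/eqP; congr N; vec.
  rewrite (normN hN) dw (normZ hN) -/g.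
  have -> : `|g^-1 - 1| * g = 1 - g.
    rewrite ger0_norm; first by field.
    by rewrite subr_ge0 invf_ge1 //; lra.
  lra.
- have -> : g^-1 *: x - w = g^-1 *: (v - (d + g) *: w).
    by rewrite /x; apply/rowP => i; rewrite !mxE; field.
  rewrite (normZ hN) gtr0_norm // mulrC ltr_pdivlMr ?mul1r; last lra.
  have [dg|dg] := ltP 1 (d + g).
    have := out (d + g - 1) ltac:(lra).
    rewrite (_ : v - w - _ = v - (d + g) *: w); last by vec.
    lra.
  have -> : d + g = 1 by lra.
  by rewrite scale1r d1; lra.
Qed.

Lemma near_lt x y x' y' a b : N (x' - x) < a -> N (y' - y) < b ->
  N (x - y) - a - b < N (x' - y').
Proof.
move=> xa yb; have : N (x - y) <= 1 * N (x' - y') + 1 * N ((y' - y) - (x' - x)).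
  by apply: (norm_comb hN); [lra|lra|vec].
have := normD hN (y' - y) (- (x' - x)); rewrite (normN hN); lra.
Qed.

Lemma common_lt a b : 0 < a -> 0 < b -> exists c, [/\ 0 < c, c <= a & c <= b].
Proof.
by move=> a0 b0; exists (Num.min a b); rewrite lt_min a0 b0 !ge_min !lexx orbT.
Qed.

(** The pairs [w], [v]; [w], [s]; [v], [p]; [s], [q] are at distance exactly 1. The order of the
    moves matters: [p] and [q] are first moved off [v] and [s], and only then [v] and [s] off [w],
    by an amount [f] small against the gaps just opened. The slack [e] protects the other six
    distances. *)
Lemma strict_packing_of_leftmost w v s p q : leftmost N w v -> leftmost N w s ->
  leftmost N v p -> leftmost N s q ->
  1 < N (v - s) -> 1 < N (p - q) -> 1 < N (w - p) -> 1 < N (w - q) ->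
  1 < N (v - q) -> 1 < N (s - p) -> exists V, strict_packing N V /\ V #= `I_5.
Proof.
move=> wv ws vp sq vs pq wp wq vq sp; have [[w1 _ _] _] := wv.
have [e1 [e10 e1a e1b]] := @common_lt (N (v - s) - 1) (N (p - q) - 1) ltac:(lra) ltac:(lra).
have [e2 [e20 e2a e2b]] := @common_lt (N (w - p) - 1) (N (w - q) - 1) ltac:(lra) ltac:(lra).
have [e3 [e30 e3a e3b]] := @common_lt (N (v - q) - 1) (N (s - p) - 1) ltac:(lra) ltac:(lra).
have [e4 [e40 e4a e4b]] := common_lt e10 e20.
have [e [e0 ea eb]] := common_lt e40 e30.
have he : 0 < e / 4 by lra.
have [p' [p1 pp pv]] := leftmost_perturb vp he.
have [q' [q1 qq qs]] := leftmost_perturb sq he.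
have [f1 [f10 f1a f1b]] := @common_lt (N (p' - v) - 1) (N (q' - s) - 1) ltac:(lra) ltac:(lra).
have [f [f0 fa fb]] := common_lt he f10.
have hf : 0 < f / 4 by lra.
have [v' [v1 vv vw]] := leftmost_perturb wv hf.
have [s' [s1 ss sw]] := leftmost_perturb ws hf.
have z0 x : N (x - x) < f / 4 by rewrite subrr (norm0 hN).
exists [set` [:: w; v'; s'; p'; q']]; apply: strict_packing_seq.
  by move=> z; rewrite !inE => /or4P[/eqP->|/eqP->|/eqP->|/orP[] /eqP->].
rewrite /= !andbT; repeat (apply/andP; split).
- by rewrite (normBC hN).
- by rewrite (normBC hN).
- by have := near_lt (z0 w) pp; lra.
- by have := near_lt (z0 w) qq; lra.
- by have := near_lt vv ss; lra.
- by have := near_lt (z0 p') vv; rewrite (normBC hN p' v'); lra.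
- by have := near_lt vv qq; lra.
- by have := near_lt ss pp; lra.
- by have := near_lt (z0 q') ss; rewrite (normBC hN q' s'); lra.
- by have := near_lt pp qq; lra.
Qed.

Hypothesis ns : nonsquare N.

(** Serves [v - s], [w - p] and [w - q]. For [t > 0] the triangle inequality gives [1 + t]; for
    [t = 0] the vector is the sum of the neighbouring vertices [u] and [u - v]. *)
Lemma gap_double u v t : hex N u v -> 0 <= t -> t < 1 ->
  1 < N (2 *: u - (1 - t) *: v).
Proof.
move=> h t0 t1; have [u1 v1 d1] := h; have [->|tn0] := eqVneq t 0.
  have h' : hex N u (u - v).
    split; rewrite ?(normBC hN u) // (_ : u - v - u = - v) ?(normN hN) //.
    by vec.
  by have := ns h'; congr (_ < N _); vec.
have : N (2 *: u) <= 1 * N (2 *: u - (1 - t) *: v) + (1 - t) * N v.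
  by apply: (norm_comb hN); [lra|lra|vec].
rewrite (normZ hN) u1 v1 ger0_norm //.
have : 0 < t by rewrite lt_neqAle eq_sym tn0.
lra.
Qed.

(** Serves [v - q] and [s - p]; both cases give the bound [2 - tau]. For [d = 0] the vector is
    [2 *: (w - s)] up to [tau *: w]; for [d > 0] the line through [s - w] in direction [s] carries
    three unit vectors and supports the ball. *)
Lemma gap_skip w s tau d : hex N w s -> hex N s (s - w - d *: s) -> 0 <= d ->
  0 <= tau -> tau < 1 -> 1 < N ((2 - tau) *: w - (2 - d) *: s).
Proof.
move=> [w1 s1 ds1] [_ q1 dq1] d0 t0 t1; have [->|dn0] := eqVneq d 0.
  have : N (2 *: (s - w)) <= 1 * N ((2 - tau) *: w - (2 - 0) *: s) + `|tau| * N w.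
    rewrite -(normZ hN) mul1r.
    rewrite (_ : 2 *: (s - w) = - ((2 - tau) *: w - (2 - 0) *: s) + - (tau *: w)).
      by apply: le_trans (normD hN _ _) _; rewrite !(normN hN).
    by vec.
  by rewrite (normZ hN) ds1 w1 !ger0_norm //; lra.
have dp : 0 < d by rewrite lt_neqAle eq_sym dn0.
have : `|- (2 - tau)| <= N (- (2 - tau) *: (s - w) + (d - tau) *: s).
  apply: (@face_support _ _ hN (s - w) s (s - w - d *: s - s) (s - w - d *: s)
    (s - w) (- d - 1) (- d) 0); rewrite ?q1 ?dq1 ?ds1 //; first [by vec | lra].
rewrite normrN ger0_norm; last lra.
rewrite (_ : _ + _ = (2 - tau) *: w - (2 - d) *: s); last by vec.
lra.
Qed.

(** Serves [p - q] when one of them needed no sliding. For [t = 0] the vector is a sum of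
    neighbouring vertices; for [t > 0] the line through [v] in direction [u] supports the ball and
    gives [2 - c]. *)
Lemma gap_bent u v t c : hex N u v -> hex N v (v - u - c *: v) ->
  N (v + t *: u) = 1 -> 0 <= t -> c < 1 ->
  1 < N ((2 - c) *: v - (1 - t) *: u).
Proof.
move=> [u1 v1 d1] hvp Nt t0 c1; have [->|tn0] := eqVneq t 0.
  by have := ns hvp; congr (_ < N _); vec.
have tp : 0 < t by rewrite lt_neqAle eq_sym tn0.
have : `|2 - c| <= N ((2 - c) *: v + (t - 1) *: u).
  apply: (@face_support _ _ hN v u (v - u) v (v + t *: u) (- 1) 0 t);
    rewrite ?v1 ?d1 ?Nt //; first [by vec | lra].
rewrite ger0_norm; last lra.
rewrite (_ : _ + _ = (2 - c) *: v - (1 - t) *: u); last by vec.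
lra.
Qed.

(** [tau], [c] and [d] measure how far [s], [p] and [q] are slid to become leftmost; [nonsquare]
    keeps all three below 1. If [c] and [d] both vanish, [p - q] is just [v - s]. *)
Lemma strict_packing_five : exists V, strict_packing N V /\ V #= `I_5.
Proof.
have [w [v0 h0]] := hex_ex.
have [c0 [_]] := hex_leftmost hN h0; move: (v0 - c0 *: w) => v wv {v0 c0 h0}.
have [hwv _] := wv; have [w1 v1 dvw] := hwv.
have hws0 : hex N w (w - v).
  by split; rewrite ?(normBC hN w) // (_ : w - v - w = - v) ?(normN hN) //; vec.
have [tau [tau0 ws]] := hex_leftmost hN hws0.
set s := w - v - tau *: w in ws.
have [hws _] := ws; have [_ s1 dsw] := hws.
have hvp0 : hex N v (v - w).
  by split=> //; rewrite (_ : v - w - v = - w) ?(normN hN) //; vec.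
have [c [c0 vp]] := hex_leftmost hN hvp0.
set p := v - w - c *: v in vp.
have [hvp _] := vp; have [_ p1 dpv] := hvp.
have hsq0 : hex N s (s - w).
  by split=> //; rewrite (_ : s - w - s = - w) ?(normN hN) //; vec.
have [d [d0 sq]] := hex_leftmost hN hsq0.
set q := s - w - d *: s in sq.
have [hsq _] := sq; have [_ q1 dqs] := hsq.
have Ntau : N (v + tau *: w) = 1.
  by rewrite -dsw; apply: norm_eq_pm; right; rewrite /s; vec.
have Nsw : N (s + tau *: w) = 1.
  by rewrite -dvw; apply: norm_eq_pm; right; rewrite /s; vec.
have tau1 : tau < 1 by apply: (hex_line_lt1 hN hwv (ns hwv)); rewrite Ntau.
have c1 : c < 1.
  apply: (hex_line_lt1 hN (hex_sym hN hwv) (ns (hex_sym hN hwv))).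
  by rewrite -dpv le_eqVlt; apply/orP; left; apply/eqP;
    apply: norm_eq_pm; right; rewrite /p; vec.
have d1 : d < 1.
  apply: (hex_line_lt1 hN (hex_sym hN hws) (ns (hex_sym hN hws))).
  by rewrite -dqs le_eqVlt; apply/orP; left; apply/eqP;
    apply: norm_eq_pm; right; rewrite /q; vec.
have gvs : 1 < N (v - s).
  by have := gap_double (hex_sym hN hwv) tau0 tau1; congr (_ < N _); rewrite /s; vec.
apply: (strict_packing_of_leftmost wv ws vp sq gvs).
- have [cz|cn0] := eqVneq c 0; have [dz|dn0] := eqVneq d 0.
  + by move: gvs; rewrite /p /q cz dz !scale0r !subr0; congr (_ < N _); vec.
  + have := gap_bent hws hsq Nsw tau0 d1; rewrite -(normN hN); congr (_ < N _).
    by rewrite /p /q cz /s; vec.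
  + have := gap_bent hwv hvp Ntau tau0 c1; congr (_ < N _).
    by rewrite /p /q dz /s; vec.
  (* [c > 0] makes the line through [w] in direction [v] support the ball, while the unit vector
     [s - q] has [w]-coordinate [1 + d * (1 - tau)], beyond it when [d > 0]. *)
  + exfalso.
    have cp : 0 < c by rewrite lt_neqAle eq_sym cn0.
    have dp : 0 < d by rewrite lt_neqAle eq_sym dn0.
    have : `|1 + d * (1 - tau)| <= N ((1 + d * (1 - tau)) *: w + (- d) *: v).
      apply: (@face_support _ _ hN w v (w - v) w (w + c *: v) (- 1) 0 c).
      * by vec.
      * by vec.
      * by [].
      * lra.
      * by [].
      * by rewrite (normBC hN) dvw.
      * by rewrite -dpv le_eqVlt; apply/orP; left; apply/eqP;
          apply: norm_eq_pm; right; rewrite /p; vec.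
      * by rewrite w1.
    have -> : N ((1 + d * (1 - tau)) *: w + (- d) *: v) = 1.
      by rewrite -[RHS]dqs; apply: norm_eq_pm; right; rewrite /q /s; vec.
    by rewrite ger0_norm; nra.
- by have := gap_double hwv c0 c1; congr (_ < N _); rewrite /p; vec.
- by have := gap_double hws d0 d1; congr (_ < N _); rewrite /q; vec.
- have := gap_skip hws hsq d0 tau0 tau1; congr (_ < N _).
  by rewrite /q /s; vec.
- have := gap_skip hwv hvp c0 tau0 tau1; congr (_ < N _).
  by rewrite /p /s; vec.
Qed.

End LowerBounds.

(** * The norm of the difference body *)

Section Bridge.
Variables (R : realType) (C : set 'rV[R]_2) (hC : convex_disc C).
Implicit Types (u v w x y z p q n : 'rV[R]_2) (a b c d e r s t : R).

Lemma interior_normP (A : set 'rV[R]_2) x :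
  A° x <-> exists2 e, 0 < e & forall y, `|x - y| < e -> A y.
Proof.
split.
  move=> /nbhs_ballP[e /= e0 eA]; exists e => // y xy; apply: eA.
  by rewrite -ball_normE.
move=> [e e0 eA]; apply/nbhs_ballP; exists e => // y.
by rewrite -ball_normE; exact: eA.
Qed.

Lemma disc_convex x y t : C x -> C y -> 0 <= t -> t <= 1 ->
  C ((1 - t) *: x + t *: y).
Proof.
move=> Cx Cy t0 t1; have [_ cvx _] := hC.
have := cvx y x (Itv01 t0 t1); rewrite !inE addrC => H.
exact: (H Cy Cx).
Qed.

Definition diff_body : set 'rV[R]_2 := [set x - y | x in C & y in C].
Notation D := diff_body.

Lemma diff_bodyN x : D x -> D (- x).
Proof. by move=> [y Cy [z Cz <-]]; exists z => //; exists y => //; rewrite opprB. Qed.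

Lemma diff_body_convex x y t : D x -> D y -> 0 <= t -> t <= 1 ->
  D ((1 - t) *: x + t *: y).
Proof.
move=> [a Ca [b Cb <-]] [c Cc [d Cd <-]] t0 t1.
exists ((1 - t) *: a + t *: c); first exact: disc_convex.
exists ((1 - t) *: b + t *: d); first exact: disc_convex.
by vec.
Qed.

Lemma diff_body_ball : exists2 r, 0 < r & forall x, `|x| < r -> D x.
Proof.
have [_ _ [c0 /interior_normP[r r0 rC]]] := hC; exists r => // x xr.
have Cc : C c0 by apply: rC; rewrite subrr normr0.
exists (c0 + x); last by exists c0 => //; vec.
by apply: rC; rewrite opprD addNKr normrN.
Qed.

Lemma diff_body0 : D 0.
Proof. by have [r r0 rD] := diff_body_ball; apply: rD; rewrite normr0. Qed.

Lemma diff_body_compact : compact D.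
Proof.
have [cC _ _] := hC.
have -> : D = (fun p : 'rV[R]_2 * 'rV[R]_2 => p.1 - p.2) @` (C `*` C).
  apply/seteqP; split=> [_ [x Cx [y Cy <-]]|_ [[x y] /= [Cx Cy] <-]].
    by exists (x, y).
  by exists x => //; exists y.
apply: continuous_compact; last exact: compact_setX.
by apply: continuous_subspaceT => x; apply: sub_continuous.
Qed.

Lemma diff_body_bounded : exists2 M, 0 < M & forall x, D x -> `|x| <= M.
Proof.
have [M [Mr HM]] := compact_bounded diff_body_compact.
exists (`|M| + 1); first by have := normr_ge0 M; lra.
by move=> x Dx; apply: (HM _ _ _ Dx); have := ler_norm M; lra.
Qed.

Lemma diff_body_shrink v s r : 0 < s -> s <= r -> D (s^-1 *: v) -> D (r^-1 *: v).
Proof.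
move=> s0 sr Dv; have r0 : 0 < r by lra.
have -> : r^-1 *: v = (1 - s / r) *: 0 + (s / r) *: (s^-1 *: v).
  by rewrite scaler0 add0r scalerA; congr (_ *: _); field; rewrite !gt_eqF.
apply: diff_body_convex => //; first exact: diff_body0.
  by rewrite divr_ge0 ?ltW.
by rewrite ler_pdivrMr // mul1r.
Qed.

Lemma diff_body_closed x : (forall s, 1 < s -> D (s^-1 *: x)) -> D x.
Proof.
move=> Ds; apply: (compact_closed _ diff_body_compact); first exact: norm_hausdorff.
move=> B /(interior_normP B)[e e0 eB].
pose d := e / (`|x| + 1).
have x0 := normr_ge0 x.
have d0 : 0 < d by rewrite divr_gt0 //; lra.
exists ((1 + d)^-1 *: x); split; first by apply: Ds; lra.
apply: eB.
have -> : x - (1 + d)^-1 *: x = (d / (1 + d)) *: x.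
  by apply/rowP => i; rewrite !mxE; field; lra.
rewrite normrZ ger0_norm; last by rewrite divr_ge0 //; lra.
have dx : d * `|x| < e.
  have -> : e = d * (`|x| + 1) by rewrite /d; field; lra.
  nra.
apply: le_lt_trans dx; rewrite ler_wpM2r // ler_pdivrMr; nra.
Qed.

Local Notation N := (gauge_norm D).

Lemma gauge_ge0 v : 0 <= N v.
Proof.
have [r r0 rD] := diff_body_ball; apply: lb_le_inf; last by move=> s [/ltW].
have v0 := normr_ge0 v.
exists ((`|v| + 1) / r); split; first by rewrite divr_gt0 //; lra.
apply: rD; rewrite normrZ invf_div gtr0_norm; last by rewrite divr_gt0 //; lra.
by rewrite mulrAC ltr_pdivrMr; nra.
Qed.

(** Closedness of [D] makes the infimum attained for nonzero vectors. Positivity of [r] matters: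
    with [0^-1 = 0] the right side would hold for every [v] at [r = 0]. *)
Lemma gauge_leP v r : 0 < r -> N v <= r <-> D (r^-1 *: v).
Proof.
move=> r0; split=> [Nr|Dv]; last first.
  by apply: ge_inf; [exists 0 => s [/ltW]|].
apply: diff_body_closed => s s1; rewrite scalerA -invfM.
have [||y [y0 Dy] yr] := @inf_lt _ [set r | 0 < r /\ D (r^-1 *: v)] (s * r).
- have [k k0 kD] := diff_body_ball; have v0 := normr_ge0 v.
  exists ((`|v| + 1) / k); split; first by rewrite divr_gt0 //; lra.
  apply: kD; rewrite normrZ invf_div gtr0_norm; last by rewrite divr_gt0 //; lra.
  by rewrite mulrAC ltr_pdivrMr; nra.
- by apply: le_lt_trans Nr _; nra.
- by apply: diff_body_shrink Dy => //; exact: ltW.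
Qed.

Lemma gauge_le1P v : N v <= 1 <-> D v.
Proof. by have := gauge_leP v ltr01; rewrite invr1 scale1r. Qed.

Lemma le_of_gt a b : (forall r, a < r -> b <= r) -> b <= a.
Proof. by move=> H; rewrite leNgt; apply/negP => ab; have := H ((a + b) / 2) ltac:(lra); lra. Qed.

Lemma gauge_scale_le a v : a != 0 -> N (a *: v) <= `|a| * N v.
Proof.
move=> a0; have na : 0 < `|a| by rewrite normr_gt0.
apply: le_of_gt => r; rewrite mulrC -ltr_pdivlMr // => vr.
have r0 : 0 < r.
  by have := le_lt_trans (gauge_ge0 v) vr; rewrite pmulr_lgt0 // invr_gt0.
have /(gauge_leP _ (divr_gt0 r0 na)) Dv := ltW vr.
apply/gauge_leP => //; move: Dv; rewrite invf_div.
have [ap|an] := leP 0 a.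
  by rewrite ger0_norm // scalerA mulrC.
rewrite ltr0_norm // => /diff_bodyN; congr (D _).
by apply/rowP => i; rewrite !mxE; field; rewrite gt_eqF.
Qed.

Lemma gauge_is_norm : is_norm N.
Proof.
split.
- move=> x y; have x0 := gauge_ge0 x; have y0 := gauge_ge0 y.
  have sum r s : N x < r -> N y < s -> N (x + y) <= r + s.
    move=> xr ys; have r0 : 0 < r by lra. have s0 : 0 < s by lra.
    have /(gauge_leP _ r0) Dx := ltW xr; have /(gauge_leP _ s0) Dy := ltW ys.
    apply/gauge_leP; first lra.
    have -> : (r + s)^-1 *: (x + y) =
        (1 - s / (r + s)) *: (r^-1 *: x) + (s / (r + s)) *: (s^-1 *: y).
      by apply/rowP => i; rewrite !mxE; field; rewrite !gt_eqF //; lra.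
    apply: diff_body_convex => //; first by rewrite divr_ge0 //; lra.
    by rewrite ler_pdivrMr; lra.
  apply: le_of_gt => r xyr.
  have := sum (N x + (r - (N x + N y)) / 2) (N y + (r - (N x + N y)) / 2).
  by move=> /(_ ltac:(lra) ltac:(lra)); lra.
- move=> a x; have [->|a0] := eqVneq a 0.
    rewrite scale0r normr0 mul0r; apply/eqP; rewrite eq_le gauge_ge0 andbT.
    apply: le_of_gt => r r0; apply/gauge_leP => //.
    by rewrite scaler0; exact: diff_body0.
  apply/eqP; rewrite eq_le gauge_scale_le //=.
  have := @gauge_scale_le a^-1 (a *: x); rewrite invr_eq0 => /(_ a0).
  rewrite scalerA mulVf // scale1r normfV => H.
  by rewrite -ler_pdivlMl // ?normr_gt0.
- move=> x Nx; have [M M0 DM] := diff_body_bounded.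
  apply/eqP; rewrite -normr_le0; apply: le_of_gt => r r0.
  have rM : 0 < r / M by rewrite divr_gt0.
  have /(gauge_leP _ rM)/DM : N x <= r / M by rewrite Nx ltW.
  by rewrite normrZ gtr0_norm ?invr_gt0 // invf_div mulrAC ler_pdivrMr // ler_pM2l.
Qed.

Lemma translate_interior v z : (translate C v)° z <-> C° (z - v).
Proof.
rewrite !interior_normP; split=> -[e e0 eC]; exists e => // y.
- move=> zy; have [|x Cx xy] := eC (v + y); first by rewrite opprD addrA.
  by move: xy => /addrI <-.
- move=> zy; exists (y - v); last by vec.
  by apply: eC; rewrite opprB addrA subrK.
Qed.

Lemma translate_meet v w :
  translate C v `&` translate C w !=set0 <-> N (v - w) <= 1.
Proof.
rewrite gauge_le1P; split.
  move=> [z [[x Cx xz] [y Cy yz]]]; exists y => //; exists x => //.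
  by rewrite -[y](addKr w) yz -xz; vec.
move=> [y Cy [x Cx vw]]; exists (v + x); split; first by exists x.
by exists y => //; rewrite -[v](subrK w) -vw; vec.
Qed.

Lemma interior_segment x y t : C° x -> C y -> 0 <= t -> t < 1 ->
  C° ((1 - t) *: x + t *: y).
Proof.
move=> /interior_normP[e e0 eC] Cy t0 t1; apply/interior_normP.
exists ((1 - t) * e); first by rewrite mulr_gt0 //; lra.
move=> z zy; have t1n : 1 - t != 0 by rewrite gt_eqF //; lra.
have -> : z = (1 - t) *: ((1 - t)^-1 *: (z - t *: y)) + t *: y.
  by apply/rowP => i; rewrite !mxE; field.
apply: disc_convex => //; last lra.
apply: eC; have -> : x - (1 - t)^-1 *: (z - t *: y) =
    (1 - t)^-1 *: ((1 - t) *: x + t *: y - z).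
  by apply/rowP => i; rewrite !mxE; field.
rewrite normrZ gtr0_norm ?invr_gt0; last lra.
by rewrite mulrC ltr_pdivrMr ?[e * _]mulrC //; lra.
Qed.

(** At distance below 1, [v - w] is [t] times a difference of points of [C] with [t < 1], and the
    spare weight [1 - t] goes to an interior point, giving a common interior point. Conversely, a
    common interior point can be pushed a little along [v - w], which puts a longer multiple of
    [v - w] into [D]. *)
Lemma translate_interior_disjoint v w :
  (translate C v)° `&` (translate C w)° = set0 <-> 1 <= N (v - w).
Proof.
have hN := gauge_is_norm; split.
- move=> dis; rewrite leNgt; apply/negP => lt1.
  have [_ _ [c0 Cc0]] := hC.
  pose t := (N (v - w) + 1) / 2.
  have Nge0 := gauge_ge0 (v - w).
  have t0 : 0 < t by rewrite /t; lra.
  have /(gauge_leP _ t0)[y Cy [x Cx yx]] : N (v - w) <= t by rewrite /t; lra.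
  have vw : v - w = t *: (y - x) by rewrite yx scalerA mulfV ?scale1r // gt_eqF.
  have : ((translate C v)° `&` (translate C w)°) (v + ((1 - t) *: c0 + t *: x)).
    split; apply/translate_interior.
      have -> : v + ((1 - t) *: c0 + t *: x) - v = (1 - t) *: c0 + t *: x by vec.
      by apply: interior_segment => //; rewrite /t; lra.
    have -> : v + ((1 - t) *: c0 + t *: x) - w = (1 - t) *: c0 + t *: y.
      by rewrite -[v](subrK w) vw; vec.
    by apply: interior_segment => //; rewrite /t; lra.
  by rewrite dis.
- move=> ge1; apply/seteqP; split=> // z [/translate_interior + /translate_interior].
  move=> /interior_normP[e e0 eC] Czw.
  have Cy : C (z - w) by move: Czw => /interior_normP[f f0]; apply; rewrite subrr normr0.
  pose x := v - w; have x0 := normr_ge0 x.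
  pose d := e / (`|x| + 1).
  have d0 : 0 < d by rewrite divr_gt0 //; lra.
  have Cx : C (z - v - d *: x).
    apply: eC; rewrite opprB addrC subrK normrZ gtr0_norm //.
    have -> : e = d * (`|x| + 1) by rewrite /d; field; lra.
    nra.
  have : D ((1 + d) *: x).
    exists (z - w) => //; exists (z - v - d *: x) => //.
    by rewrite /x; vec.
  move=> /gauge_le1P; rewrite (normZ hN) ger0_norm; last lra.
  by rewrite -/x in ge1; nra.
Qed.

Lemma translate0 : translate C 0 = C.
Proof.
apply/seteqP; split=> [_ [x Cx <-]|x Cx]; first by rewrite add0r.
by exists x; rewrite ?add0r.
Qed.

Lemma touchE v : touch (translate C v) C <-> N v = 1.
Proof.
rewrite /touch -{2 4}translate0 translate_meet translate_interior_disjoint subr0.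
split=> [[le1 ge1]|->]; last by [].
by apply/eqP; rewrite eq_le le1 ge1.
Qed.

Lemma hadwiger_familyE V : hadwiger_family C V <-> packing N V.
Proof.
split=> -[T P]; split.
- by move=> v /T /touchE.
- move=> v w Vv Vw vw; apply/translate_interior_disjoint.
  apply/seteqP; split=> // z zz; case: vw; apply: P => //; by exists z.
- by move=> v /T /touchE.
- move=> v w Vv Vw; have [//|vw] := pselect (v = w).
  by have /translate_interior_disjoint -> := P v w Vv Vw vw => -[].
Qed.

Lemma strict_hadwiger_familyE V : strict_hadwiger_family C V <-> strict_packing N V.
Proof.
split=> -[T P]; split.
- by move=> v /T /touchE.
- move=> v w Vv Vw vw; rewrite ltNge; apply/negP => /translate_meet m.
  by apply: vw; apply: P.
- by move=> v /T /touchE.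
- move=> v w Vv Vw /translate_meet m; have [//|vw] := pselect (v = w).
  by have := P v w Vv Vw vw; rewrite ltNge m.
Qed.

(** The difference body of [p + [0, 1] u + [0, 1] w] is [[-1, 1] u + [-1, 1] w], the unit ball of
    the maximum norm. *)
Lemma parallelogram_square : parallelogram C -> exists u v, square_basis N u v.
Proof.
move=> [p [u [w [free eC]]]]; exists u, w.
have ind : indep u w.
  move=> a b e0; have := @row_free_inj _ 1 _ _ _ free (row_mx a%:M b%:M) 0.
  rewrite mul_row_col !mul_scalar_mx e0 mul0mx => /(_ erefl) e.
  have [] := eq_row_mx (etrans e (esym (row_mx0 _ _ _ _))).
  by move=> /matrixP/(_ 0 0) + /matrixP/(_ 0 0); rewrite !mxE.
split=> // a b.
have DE s t : D (s *: u + t *: w) <-> Num.max `|s| `|t| <= 1.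
  rewrite ge_max; split.
    move=> [x Cx [y Cy e]]; move: Cx Cy; rewrite eC.
    move=> [s1 + [t1 + e1]] [s2 + [t2 + e2]]; rewrite /= !in_itv /=.
    move: e; rewrite -e1 -e2 => e /andP[? ?] /andP[? ?] /andP[? ?] /andP[? ?].
    have [es et] : s1 - s2 - s = 0 /\ t1 - t2 - t = 0.
      apply: ind; have : s *: u + t *: w - (s *: u + t *: w) = 0 by rewrite subrr.
      by rewrite -{1}e => <-; vec.
    by rewrite !ler_norml; lra.
  rewrite !ler_norml => /andP[/andP[? ?] /andP[? ?]].
  (* Positive and negative parts write a coordinate in [-1, 1] as a difference of two in [0, 1]. *)
  have pos c : exists c1 c2, [/\ `|c| <= 1 -> 0 <= c1 <= 1, `|c| <= 1 -> 0 <= c2 <= 1 &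
      c = c1 - c2].
    have [c0|c0] := leP 0 c.
      by exists c, 0; rewrite ler_norml; split=> [||]; lra.
    by exists 0, (- c); rewrite ler_norml; split=> [||]; lra.
  have [s1 [s2 [s1i s2i es]]] := pos s; have [t1 [t2 [t1i t2i et]]] := pos t.
  have ns : `|s| <= 1 by rewrite ler_norml; lra.
  have nt : `|t| <= 1 by rewrite ler_norml; lra.
  exists (p + s1 *: u + t1 *: w).
    by rewrite eC; exists s1; [exact: s1i|exists t1; [exact: t1i|]].
  exists (p + s2 *: u + t2 *: w).
    by rewrite eC; exists s2; [exact: s2i|exists t2; [exact: t2i|]].
  by rewrite es et; vec.
have key r : 0 < r -> (N (a *: u + b *: w) <= r <-> Num.max `|a| `|b| <= r).
  move=> r0; rewrite gauge_leP // (_ : r^-1 *: _ = (a / r) *: u + (b / r) *: w).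
    rewrite DE !normrM normfV (gtr0_norm r0) !ge_max.
    by rewrite !ler_pdivrMr // !mul1r.
  by vec.
have m0 : 0 <= Num.max `|a| `|b| by rewrite le_max normr_ge0.
have n0 := gauge_ge0 (a *: u + b *: w).
apply/eqP; rewrite eq_le; apply/andP; split; apply: le_of_gt => r hr.
  by apply/key; [lra|exact: ltW].
by apply/key; [lra|exact: ltW].
Qed.

(** Only parallelograms have a parallelogram as difference body. The corners [u + v] and [u - v] of
    the ball are differences of points of [C]; since coordinates within [C] differ by at most 1,
    these four points must be the corners of a parallelogram, and the same bounds confine [C] to
    it. *)
Lemma square_parallelogram u v : hex N u v -> N (u + v) <= 1 -> parallelogram C.
Proof.
move=> h uv; have hN := gauge_is_norm.
have sq := hex_square hN h uv; have ind := hex_indep hN h.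
have dif x y : C x -> C y -> N (x - y) <= 1.
  by move=> Cx Cy; apply/gauge_le1P; exists x => //; exists y.
have [p1 Cp1 [p Cp ep]] : D (u + v) by apply/gauge_le1P.
have [q1 Cq1 [q Cq eq]] : D (u - v).
  by apply/gauge_le1P; rewrite (normBC hN); have [_ _ ->] := h.
have {}ep : p1 = p + u + v by rewrite -addrA -ep; vec.
have {}eq : q1 = q + u - v by rewrite -addrA -eq; vec.
have coord x y a b : C x -> C y -> x - y = a *: u + b *: v -> `|a| <= 1 /\ `|b| <= 1.
  move=> Cx Cy e; have := dif _ _ Cx Cy; rewrite e sq ge_max => /andP[]; by [].
have [a [b eqp]] := indep_span ind (q - p).
have qE : q = p + a *: u + b *: v by rewrite -addrA -eqp; vec.
have [a1 b1] := coord _ _ _ _ Cq Cp eqp.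
have [a2 b2] : `|a + 1| <= 1 /\ `|b - 1| <= 1.
  by apply: (coord _ _ _ _ Cq1 Cp); rewrite eq qE; vec.
have [a3 b3] : `|a - 1| <= 1 /\ `|b - 1| <= 1.
  by apply: (coord _ _ _ _ Cq Cp1); rewrite ep qE; vec.
have [a4 b4] : `|a| <= 1 /\ `|b - 2| <= 1.
  by apply: (coord _ _ _ _ Cq1 Cp1); rewrite ep eq qE; vec.
move: a1 b1 a2 b2 a3 b3 a4 b4; rewrite !ler_norml.
move=> /andP[? ?] /andP[? ?] /andP[? ?] /andP[? ?] /andP[? ?] /andP[? ?] /andP[? ?] /andP[? ?].
have ea : a = 0 by lra.
have eb : b = 1 by lra.
have Cpv : C (p + v) by move: Cq; rewrite qE ea eb scale0r addr0 scale1r.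
have Cpu : C (p + u).
  by move: Cq1; rewrite eq qE ea eb (_ : _ - v = p + u) //; vec.
exists p, u, v; split.
  apply: inj_row_free => z; rewrite -[z]hsubmxK mul_row_col.
  rewrite [lsubmx z]mx11_scalar [rsubmx z]mx11_scalar !mul_scalar_mx.
  by move=> /ind[-> ->]; rewrite !raddf0 row_mx0.
apply/seteqP; split=> [z Cz|_ [s /= + [t + <-]]].
  have [s [t e]] := indep_span ind (z - p).
  have [s1 t1] := coord _ _ _ _ Cz Cp e.
  have [s2 t2] : `|s - 1| <= 1 /\ `|t - 1| <= 1.
    by apply: (coord _ _ _ _ Cz Cp1); rewrite ep -[z](subrK p) e; vec.
  move: s1 t1 s2 t2; rewrite !ler_norml.
  move=> /andP[? ?] /andP[? ?] /andP[? ?] /andP[? ?].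
  exists s; first by rewrite /= in_itv /=; lra.
  exists t; first by rewrite /= in_itv /=; lra.
  by rewrite -addrA -e; vec.
rewrite !in_itv /= => /andP[s0 s1] /andP[t0 t1].
have -> : p + s *: u + t *: v = (1 - t) *: ((1 - s) *: p + s *: (p + u)) +
    t *: ((1 - s) *: (p + v) + s *: (p + u + v)) by vec.
by rewrite -ep; do ?[apply: disc_convex => //].
Qed.

Lemma half_differenceP x : half_difference C x <-> D (2 *: x).
Proof.
split=> [[y Cy [z Cz <-]]|[y Cy [z Cz e]]].
  by exists y => //; exists z => //; rewrite scalerA mulfV ?scale1r.
by exists y => //; exists z => //; rewrite e scalerA mulVf ?scale1r.
Qed.

Lemma half_gauge x : gauge_norm (half_difference C) x = 2 * N x.
Proof.
have hN := gauge_is_norm; rewrite -[2 in RHS]ger0_norm // -(normZ hN).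
congr inf; apply/seteqP; split=> r /= [r0].
  by move=> /half_differenceP H; split=> //; move: H; congr D; vec.
by move=> H; split=> //; apply/half_differenceP; move: H; congr D; vec.
Qed.

Lemma gauge_bound : exists2 K, 0 < K & forall x, N x <= K * `|x|.
Proof.
have hN := gauge_is_norm; have [r r0 rD] := diff_body_ball.
exists (2 / r); first by rewrite divr_gt0.
move=> x; have [->|x0] := eqVneq x 0; first by rewrite (norm0 hN) normr0 mulr0.
have nx : 0 < `|x| by rewrite normr_gt0.
apply/gauge_leP; first by rewrite mulr_gt0 // divr_gt0.
apply: rD; rewrite normrZ gtr0_norm; last by rewrite invr_gt0 mulr_gt0 // divr_gt0.
have -> : (2 / r * `|x|)^-1 * `|x| = r / 2.
  by field; rewrite !gt_eqF.
lra.
Qed.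

Lemma frontier_half x : frontier (half_difference C) x <-> N (2 *: x) = 1.
Proof.
have hN := gauge_is_norm; have [K K0 NK] := gauge_bound.
have near y z : N (2 *: y) <= N (2 *: z) + 2 * K * `|z - y|.
  have : N (2 *: y) <= 1 * N (2 *: z) + 2 * N (y - z).
    by apply: (norm_comb hN) => //; vec.
  have := NK (y - z); rewrite distrC; lra.
split=> [[clo nint]|N1].
- apply/eqP; rewrite eq_le; apply/andP; split; rewrite leNgt; apply/negP => lt1.
    have e0 : 0 < (N (2 *: x) - 1) / (2 * K) by rewrite divr_gt0 //; lra.
    have [|y [/half_differenceP/gauge_le1P y1 /= xy]] :=
      clo [set y | `|x - y| < (N (2 *: x) - 1) / (2 * K)].
      by apply/interior_normP; exists ((N (2 *: x) - 1) / (2 * K)).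
    have := near x y; rewrite distrC.
    by move: xy; rewrite ltr_pdivlMr; lra.
  apply: nint; apply/interior_normP.
  exists ((1 - N (2 *: x)) / (2 * K)); first by rewrite divr_gt0 //; lra.
  move=> y xy; apply/half_differenceP/gauge_le1P.
  by have := near y x; move: xy; rewrite ltr_pdivlMr; lra.
- have Bx : half_difference C x by apply/half_differenceP/gauge_le1P; rewrite N1.
  split; first exact: subset_closure.
  move=> /interior_normP[e e0 eB]; have x0 := normr_ge0 x.
  pose d := e / (`|x| + 1).
  have d0 : 0 < d by rewrite divr_gt0 //; lra.
  have /eB/half_differenceP/gauge_le1P : `|x - (1 + d) *: x| < e.
    have -> : x - (1 + d) *: x = - (d *: x) by vec.
    rewrite normrN normrZ gtr0_norm //.
    have -> : e = d * (`|x| + 1) by rewrite /d; field; lra.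
    nra.
  rewrite (_ : 2 *: _ = (1 + d) *: (2 *: x)); last by vec.
  by rewrite (normZ hN) N1 mulr1 ger0_norm; lra.
Qed.

(** Doubling maps the boundary of [half_difference C] onto the unit circle of [N] and preserves
    lengths, each measured in its own norm. *)
Lemma long_face_lambda : long_face N <-> 1 < lambda (half_difference C).
Proof.
have hN := gauge_is_norm.
have ends x y : segment x y `<=` frontier (half_difference C) ->
    N (2 *: x) = 1 /\ N (2 *: y) = 1.
  move=> s; split; apply/frontier_half; apply: s.
    by exists 0; [rewrite /= in_itv /=; lra|vec].
  by exists 1; [rewrite /= in_itv /=; lra|vec].
have ub : has_ubound [set l | exists x y : 'rV[R]_2,
    segment x y `<=` frontier (half_difference C) /\
    l = gauge_norm (half_difference C) (y - x)].
  exists 2 => _ [x [y [/ends[x1 y1] ->]]]; rewrite half_gauge.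
  have : N (y - x) <= (1 / 2) * N (2 *: y) + (1 / 2) * N (- (2 *: x)).
    by apply: (norm_comb hN); [lra|lra|vecf].
  by rewrite (normN hN) x1 y1; lra.
split.
- move=> [x [y [seg L1]]]; apply: lt_le_trans L1 _.
  apply: ub_le_sup => //; exists (2^-1 *: x), (2^-1 *: y); split.
    move=> _ [t /= + <-]; rewrite in_itv /= => t01.
    apply/frontier_half.
    rewrite (_ : 2 *: _ = (1 - t) *: x + t *: y); last by vecf.
    exact: seg.
  by rewrite half_gauge -scalerBr (normZ hN) ger0_norm ?mulrA ?mulfV ?mul1r.
(* A supremum above 1 yields a member above 1; the side goal, that the set is nonempty, is met by a
   one-point segment. *)
- move=> /sup_gt[|_ [x [y [seg ->]]] L1].
    have [u [v h]] := hex_ex hN; have [u1 _ _] := h.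
    exists (gauge_norm (half_difference C) (2^-1 *: u - 2^-1 *: u)).
    exists (2^-1 *: u), (2^-1 *: u); split=> // _ [t _ <-].
    by apply/frontier_half; rewrite (_ : 2 *: _ = u) //; vecf.
  exists (2 *: x), (2 *: y); split.
    move=> t t01; rewrite (_ : _ + _ = 2 *: ((1 - t) *: x + t *: y)); last by vec.
    by apply/frontier_half; apply: seg; exists t.
  by move: L1; rewrite half_gauge -scalerBr (normZ hN) ger0_norm.
Qed.

End Bridge.

(** * Maximum cardinalities and the final counts *)

Lemma max_cardinality_eq (T : Type) (P : set (set T)) n :
  (exists2 V, P V & V #= `I_n) -> (forall V, P V -> V #<= `I_n) ->
  max_cardinality P = n.
Proof.
move=> ex ub; apply: xget_unique; first by split.
move=> m [[W PW Wm] ubm]; have [V PV Vn] := ex.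
apply/eqP; rewrite eqn_leq -!card_le_II.
rewrite -(card_le_eql Wm) ub //= -(card_le_eql Vn); exact: ubm.
Qed.

Theorem proposition23 (R : realType) (C : set 'rV[R]_2) (hC : convex_disc C) :
  [/\ (~ parallelogram C -> hadwiger_number C = 6%N) /\
      (parallelogram C -> hadwiger_number C = 8%N),
      (~ parallelogram C -> strict_hadwiger_number C = 5%N) /\
      (parallelogram C -> strict_hadwiger_number C = 4%N),
      (~ parallelogram C -> one_sided_hadwiger_number C = 4%N) /\
      (parallelogram C -> one_sided_hadwiger_number C = 5%N) &
      (1 < lambda (half_difference C) ->
         open_one_sided_hadwiger_number C = 4%N) /\
      (~ (1 < lambda (half_difference C)) ->
         open_one_sided_hadwiger_number C = 3%N)].
Proof.
have hN := gauge_is_norm hC.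
have ns : ~ parallelogram C -> nonsquare (gauge_norm (diff_body C)).
  move=> npar u v h; rewrite ltNge; apply/negP => uv.
  exact: npar (square_parallelogram hC h uv).
have closedE (V : set 'rV[R]_2) n : V `<=` closed_half_plane n -> forall z, V z -> 0 <= dot z n.
  by move=> Vn z /Vn.
have openE (V : set 'rV[R]_2) n : V `<=` open_half_plane n -> forall z, V z -> 0 < dot z n.
  by move=> Vn z /Vn.
split; split.
- move=> npar; apply: max_cardinality_eq.
    by have [V [pV cV]] := packing_six hN; exists V => //; apply/hadwiger_familyE.
  move=> V /(hadwiger_familyE hC) pV; apply: atmost_card.
  exact: (nonsquare_atmost_six hN pV (ns npar)).
- move=> /(parallelogram_square hC)[u [v sb]]; apply: max_cardinality_eq.
    by have [V [pV cV]] := square_packing_eight hN sb; exists V => //;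
       apply/hadwiger_familyE.
  move=> V /(hadwiger_familyE hC) pV; apply: atmost_card.
  exact: square_atmost_eight sb pV.
- move=> npar; apply: max_cardinality_eq.
    by have [V [pV cV]] := strict_packing_five hN (ns npar); exists V => //;
       apply/strict_hadwiger_familyE.
  move=> V /(strict_hadwiger_familyE hC) pV; apply: atmost_card.
  exact: (nonsquare_strict_atmost_five hN pV (ns npar)).
- move=> /(parallelogram_square hC)[u [v sb]]; apply: max_cardinality_eq.
    by have [V [pV cV]] := square_strict_packing_four hN sb; exists V => //;
       apply/strict_hadwiger_familyE.
  move=> V /(strict_hadwiger_familyE hC) pV; apply: atmost_card.
  exact: square_strict_atmost_four sb pV.
- move=> npar; apply: max_cardinality_eq.
    have [V [pV cV [n /eqP n0 Vn]]] := packing_closed_four hN.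
    by exists V => //; split; [apply/hadwiger_familyE|exists n].
  move=> V [/(hadwiger_familyE hC) pV [n /eqP n0 /closedE Vn]].
  by apply: atmost_card; exact: (nonsquare_atmost_four hN pV (ns npar) n0 Vn).
- move=> /(parallelogram_square hC)[u [v sb]]; apply: max_cardinality_eq.
    have [V [pV cV [n /eqP n0 Vn]]] := square_packing_closed_five hN sb.
    by exists V => //; split; [apply/hadwiger_familyE|exists n].
  move=> V [/(hadwiger_familyE hC) pV [n /eqP n0 /closedE Vn]].
  by apply: atmost_card; have [H _] := square_atmost_half sb pV n0; exact: H.
- move=> /(long_face_lambda hC) lf; apply: max_cardinality_eq.
    have [V [pV cV [n /eqP n0 Vn]]] := packing_open_four hN lf.
    by exists V => //; split; [apply/hadwiger_familyE|exists n].
  move=> V [/(hadwiger_familyE hC) pV [n /eqP n0 /openE Vn]]; apply: atmost_card.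
  (* A ball with a long face may be a parallelogram or not: in the first case the bound comes from
     unit arcs, in the second from the closed half plane. *)
  have [/(parallelogram_square hC)[u [v sb]]|npar] := pselect (parallelogram C).
    by have [_ H] := square_atmost_half sb pV n0; exact: H.
  apply: (nonsquare_atmost_four hN pV (ns npar) n0) => z Vz.
  exact/ltW/Vn.
- move=> /(contra_not (long_face_lambda hC).1) nlf; apply: max_cardinality_eq.
    have [V [pV cV [n /eqP n0 Vn]]] := packing_open_three hN.
    by exists V => //; split; [apply/hadwiger_familyE|exists n].
  move=> V [/(hadwiger_familyE hC) pV [n /eqP n0 /openE Vn]]; apply: atmost_card.
  exact: (no_long_face_atmost_three hN pV nlf n0 Vn).
Qed.
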